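(* Let $A\in\mathbb M_m$ be a Perron-like matrix with principal eigenvalue $s=s(A)$, let $\delta>0$ be such that $\mathrm{Re}\,\mu\le s-2\delta$ for all $\mu\in\sigma(A)\setminus\{s\}$, and let $V=[v_i]_{i\in J}\in\mathbb M_m$ be nonsingular with $\|V\|=1$. Let $q(t)$, $\Xi$ and $\kappa$ be as defined in the context, and put $$X_n(t)=\sum_{k=0}^n\frac{t^k}{k!}A^kV,\qquad \vartheta_n(t)=\kappa^{-1}e^{2\|A\|t}\left(\frac{e\|A\|t}{n+1}\right)^{n+1}.$$ Then there exist positive constants $B_0,B_1,B_2$ such that for all $n\in\mathbb N$ and all $t\ge1$, $$\left\|\frac{X_n(t)}{\|X_n(t)\|}-q(t)\right\|\le B_0e^{-\delta t}+\vartheta_n(t)\,o(1),$$ $$\left\|\frac{X_n(t)}{\|X_n(t)\|}-\Xi\right\|\le O(t^{-1})+B_1e^{-\delta t}+\vartheta_n(t)\,o(1),$$ $$\left|\frac1{\|X_n(t)\|^2}\langle AX_n(t),X_n(t)\rangle-s\right|\le O(t^{-1})+B_2e^{-\delta t}+\|A\|\vartheta_n(t)\,o(1),$$ where $o(1)$ is an infinitesimal as $n\to\infty$ which depends only upon $n$.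
   Context: $J=\{1,\dots,m\}$; $\mathbb N$ is the set of nonnegative integers. $\mathbb M_m$ is the space of real $m\times m$ matrices; $[\alpha_i]_{i\in J}$ denotes the matrix with columns $\alpha_i$. $\mathbb R^m$ carries the Euclidean inner product and norm; on $\mathbb M_m$, $\langle[\alpha_i],[\beta_i]\rangle=\sum_{i\in J}\langle\alpha_i,\beta_i\rangle$ and $\|M\|=\langle M,M\rangle^{1/2}$. $\sigma(A)$ is the set of (complex) eigenvalues of $A$, $s(A)=\max\{\mathrm{Re}\,\mu:\mu\in\sigma(A)\}$. $A$ is Perron-like if $s:=s(A)\in\sigma(A)$ and $\mathrm{Re}\,\mu<s$ for all $\mu\in\sigma(A)\setminus\{s\}$; $s$ is then called the principal eigenvalue. $\mathrm{GE}_s(A)=\{\xi\in\mathbb R^m:(A-sI)^k\xi=0\text{ for some }k\ge1\}$. For any $\mu\in\sigma(A)$, $\mathrm{GE}_\mu(A)\subset\mathbb R^m$ is the set of all real and imaginary parts of vectors $u\in\mathbb C^m$ with $(A-\mu I)^ku=0$ for some $k\ge1$. Then $\mathbb R^m=E_1\oplus E_2$ with $E_1=\mathrm{GE}_s(A)$, $E_2=\sum_{\mu\in\sigma(A)\setminus\{s\}}\mathrm{GE}_\mu(A)$, and $\Pi_1$ is the projection onto $E_1$ along $E_2$. The cyclic order $\nu=\mathrm{Cord}(\mathrm{GE}_s(A))$ is the smallest $\nu\ge1$ with $(A-sI)^\nu\mathrm{GE}_s(A)=\{0\}$. Put $y_i=\Pi_1v_i$, $Y=[y_i]_{i\in J}$,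 $Q_{y_i}(t)=e^{t(A-sI)}y_i=\sum_{k=0}^{\nu-1}\frac{t^k}{k!}(A-sI)^ky_i$, $Q_Y(t)=[Q_{y_i}(t)]_{i\in J}$, and $q(t)=Q_Y(t)/\|Q_Y(t)\|$. Put $w_i=\frac1{(\nu-1)!}(A-sI)^{\nu-1}y_i$, $\omega=(\sum_{i\in J}\|w_i\|^2)^{1/2}$ (which is positive), $\xi_i=\omega^{-1}w_i$, $\Xi=[\xi_i]_{i\in J}$. $\kappa>0$ is a constant such that $e^{-st}t^{-(\nu-1)}\|e^{tA}V\|\ge\kappa$ and $t^{-(\nu-1)}\|Q_Y(t)\|\ge\kappa$ for all $t\ge1$ (such a constant exists). $O(t^{-1})$ denotes a quantity bounded by $Ct^{-1}$ with $C>0$ independent of $t$ and $n$. *)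

(* Defs.v *)
From HB Require Import structures.
From mathcomp Require Export all_boot all_order all_algebra.
From mathcomp Require Export complex.
From mathcomp Require Export all_classical all_reals all_analysis.

Set Implicit Arguments.
Unset Strict Implicit.
Unset Printing Implicit Defensive.

Export Order.TTheory GRing.Theory Num.Theory.
Export numFieldNormedType.Exports.

Local Open Scope classical_set_scope.
Local Open Scope complex_scope.
Local Open Scope ring_scope.

Definition of_cols (R : realType) (m : nat) (a : 'I_m -> 'cV[R]_m) : 'M[R]_m :=
  \matrix_(i, j) a j i 0.

Definition vdot (R : realType) (m : nat) (x y : 'cV[R]_m) : R :=
  \sum_(i < m) x i 0 * y i 0.

Definition mdot (R : realType) (m : nat) (M N : 'M[R]_m) : R :=
  \sum_(i < m) vdot (col i M) (col i N).

(* The Euclidean (Frobenius) norm; MathComp-Analysis' `|M| on matrices is the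
   maximum norm. *)
Definition mnorm (R : realType) (m : nat) (M : 'M[R]_m) : R :=
  Num.sqrt (mdot M M).

Definition vnorm (R : realType) (m : nat) (x : 'cV[R]_m) : R :=
  Num.sqrt (vdot x x).

Definition complexify (R : realType) (m : nat) (A : 'M[R]_m) : 'M[R[i]]_m :=
  map_mx (fun x : R => x%:C) A.

(* The library predicate [eigenvalue] speaks of row eigenvectors; a square
   matrix has the same eigenvalues for rows and for columns. *)
Definition spectrum (R : realType) (m : nat) (A : 'M[R]_m) : set R[i] :=
  [set mu | eigenvalue (complexify A) mu].

(* The maximum of a finite set, nonempty as soon as 0 < m. *)
Definition spec_abscissa (R : realType) (m : nat) (A : 'M[R]_m) : R :=
  sup [set complex.Re mu | mu in spectrum A].

Definition perron_like (R : realType) (m : nat) (A : 'M[R]_m) : Prop :=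
  let s := spec_abscissa A in
  spectrum A s%:C /\
  forall mu : R[i], (spectrum A `\ s%:C) mu -> complex.Re mu < s.

Definition GE_real (R : realType) (m : nat) (A : 'M[R]_m) (s : R) :
    set 'cV[R]_m :=
  [set xi | exists2 k : nat, (1 <= k)%N & (A - s%:M) ^+ k *m xi = 0].

Definition GE (R : realType) (m : nat) (A : 'M[R]_m) (mu : R[i]) :
    set 'cV[R]_m :=
  [set x | exists u : 'cV[R[i]]_m,
     (exists2 k : nat, (1 <= k)%N & (complexify A - mu%:M) ^+ k *m u = 0) /\
     (x = map_mx (@complex.Re R) u \/ x = map_mx (@complex.Im R) u)].

Definition E1 (R : realType) (m : nat) (A : 'M[R]_m) : set 'cV[R]_m :=
  GE_real A (spec_abscissa A).

Definition E2 (R : realType) (m : nat) (A : 'M[R]_m) : set 'cV[R]_m :=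
  let D := spectrum A `\ (spec_abscissa A)%:C in
  [set x | exists z : R[i] -> 'cV[R]_m,
     (forall mu, D mu -> GE A mu (z mu)) /\ x = \sum_(mu \in D) z mu].

(* The y in E1 with x - y in E2, which exists and is unique when
   R^m = E1 (+) E2. *)
Definition Pi1 (R : realType) (m : nat) (A : 'M[R]_m) (x : 'cV[R]_m) :
    'cV[R]_m :=
  xget 0 [set y | E1 A y /\ E2 A (x - y)].

Definition kills_E1 (R : realType) (m : nat) (A : 'M[R]_m) (k : nat) : Prop :=
  [set (A - (spec_abscissa A)%:M) ^+ k *m xi | xi in E1 A] = [set 0].

Definition cord (R : realType) (m : nat) (A : 'M[R]_m) : nat :=
  xget 1%N [set nu : nat | [/\ (1 <= nu)%N, kills_E1 A nu &
    forall k : nat, (1 <= k)%N -> kills_E1 A k -> (nu <= k)%N]].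

Definition taylor (R : realType) (m : nat) (A : 'M[R]_m) (t : R) (n : nat) :
    'M[R]_m :=
  \sum_(k < n.+1) (t ^+ k / k`!%:R) *: A ^+ k.

(* e^(tA), a limit in the entrywise topology. *)
Definition mexp (R : realType) (m : nat) (A : 'M[R]_m) (t : R) : 'M[R]_m :=
  limn (taylor A t).

Definition yvec (R : realType) (m : nat) (A V : 'M[R]_m) (i : 'I_m) :
    'cV[R]_m :=
  Pi1 A (col i V).

Definition QY (R : realType) (m : nat) (A V : 'M[R]_m) (t : R) : 'M[R]_m :=
  of_cols (fun i => mexp (A - (spec_abscissa A)%:M) t *m yvec A V i).

(* Division by zero gives 0, so [normalize 0 = 0]. *)
Definition normalize (R : realType) (m : nat) (M : 'M[R]_m) : 'M[R]_m :=
  (mnorm M)^-1 *: M.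

Definition q (R : realType) (m : nat) (A V : 'M[R]_m) (t : R) : 'M[R]_m :=
  normalize (QY A V t).

Definition wvec (R : realType) (m : nat) (A V : 'M[R]_m) (i : 'I_m) :
    'cV[R]_m :=
  ((cord A).-1`!%:R)^-1 *:
    ((A - (spec_abscissa A)%:M) ^+ (cord A).-1 *m yvec A V i).

Definition omega (R : realType) (m : nat) (A V : 'M[R]_m) : R :=
  Num.sqrt (\sum_(i < m) vnorm (wvec A V i) ^+ 2).

Definition Xi (R : realType) (m : nat) (A V : 'M[R]_m) : 'M[R]_m :=
  of_cols (fun i => (omega A V)^-1 *: wvec A V i).

Definition is_kappa (R : realType) (m : nat) (A V : 'M[R]_m) (kappa : R) :
    Prop :=
  0 < kappa /\
  forall t : R, 1 <= t ->
    kappa <= expR (- (spec_abscissa A * t)) * t ^- (cord A).-1 *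
               mnorm (mexp A t *m V) /\
    kappa <= t ^- (cord A).-1 * mnorm (QY A V t).

Definition Xn (R : realType) (m : nat) (A V : 'M[R]_m) (n : nat) (t : R) :
    'M[R]_m :=
  \sum_(k < n.+1) (t ^+ k / k`!%:R) *: (A ^+ k *m V).

Definition theta (R : realType) (m : nat) (A : 'M[R]_m) (kappa : R) (n : nat)
    (t : R) : R :=
  kappa^-1 * expR (2 * mnorm A * t) *
    (expR 1 * mnorm A * t / n.+1%:R) ^+ n.+1.

(* Main.v *)
Require Import Defs.
From mathcomp Require Import ring lra.

(* Decomposing each vector into complex generalized eigenvectors u, with
   (A - mu)^k u = 0, gives e^(tA) u = e^(t mu) sum_(j < k) t^j/j! (A - mu)^j u,
   so that e^(t(A-s)) V differs from Q_Y(t) by O(e^(-delta t)), while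
   t^(1-nu) Q_Y(t) = W + O(1/t) with A W = s W, and kappa forces W <> 0.
   Normalization satisfies |x/|x| - y/|y|| <= 2 |x - y| / |y|, which turns these
   estimates into those of the theorem.  The Taylor remainder is at most
   (|A| t)^(n+1) / (n+1)! e^(|A| t), and |e^(tA) V| >= kappa e^(-|A| t) since
   |s| <= |A|; hence o(1) = 4 ((n+1)/e)^(n+1) / (n+1)!, which tends to 0 like
   1 / sqrt n. *)

Set Implicit Arguments.
Unset Strict Implicit.
Unset Printing Implicit Defensive.

Local Open Scope classical_set_scope.
Local Open Scope complex_scope.
Local Open Scope ring_scope.

(** * Lower bound on factorials *)

(** [mexp] is a bare limit, so its convergence must be established before anything can be said about
    it. It comes from scalar series alone: on a generalized eigenvector the Taylor sums are a finite
    combination of partial sums of the scalar exponential, and testing on basis vectors carries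
    convergence over to matrices. The eigenvalues are complex while A is real, so vectors are
    decomposed over the complex numbers and real parts are taken afterwards. The spectral gap is 2
    delta because half of it is spent on absorbing powers of t. The infinitesimal is chosen before
    m, A, V and kappa; this is possible because, in the ratio of the Taylor remainder to theta, the
    powers of t |A| cancel and only a number depending on n survives. Finally, X_n(t) may vanish, so
    every normalization estimate divides by the norm of the other matrix. *)

Definition stir (R : realType) (k : nat) : R := (k%:R / expR 1) ^+ k / k`!%:R.

(* With p = 1 + u + u^2/2 <= exp u: p^2 - 2 u p - 1 = u^4 / 4. *)
Lemma expRN_sub_le (R : realType) (u : R) : 0 <= u ->
  2 * u <= expR u - expR (- u).
Proof.
move=> u0; have e2 : 1 + u + u ^+ 2 / 2 <= expR u.
  have := @exp_coeff_ge0 R u.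
  rewrite /expR => h.
  have cv := is_cvg_series_exp_coeff u.
  apply: le_trans (nondecreasing_cvgn_le _ cv 3%N).
    by rewrite /series/= !big_nat_recr //= big_geq // /exp_coeff/= add0r expr0 expr1 !divr1 (_ : 2`! = 2)%N.
  apply/nondecreasing_seqP => n; rewrite /series /= big_nat_recr //= lerDl.
  exact: h.
set p := 1 + u + _ in e2.
have p0 : 0 < p by rewrite /p; nra.
rewrite expRN.
have : (expR u)^-1 <= p^-1 by rewrite lef_pV2 // posrE ?expR_gt0.
suff : 2 * u <= p - p^-1 by lra.
rewrite -(ler_pM2r p0) mulrBl mulVf ?gt_eqF // /p.
have := sqr_ge0 (u ^+ 2).
nra.
Qed.

(** Put x = n + 1 and u = ln (1 + 1/x). The bound 2 u <= e^u - e^(-u) reads 2 u <= (1 + 1/x) - x/(x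
    + 1), and multiplying by x gives 2 x u <= 2 - 1/(x + 1). This second-order gain over (1 + 1/x)^x
    <= e is what makes [stir] tend to 0. *)
Lemma expr1V_le_exp (R : realType) (n : nat) :
  (1 + n.+1%:R^-1) ^+ n.+1 <= expR (1 - (2 * n.+2%:R)^-1) :> R.
Proof.
have a0 : (0 : R) < n.+1%:R by rewrite ltr0n.
have b0 : (0 : R) < 1 + n.+1%:R^-1 by rewrite addr_gt0 ?invr_gt0.
rewrite -[1 + _]lnK ?posrE // -expRM_natl ler_expR.
have u0 : (0 : R) <= ln (1 + n.+1%:R^-1).
  by rewrite ln_ge0 // lerDl invr_ge0 ltW.
have := expRN_sub_le u0; rewrite expRN lnK ?posrE // => h.
set L := ln _ in h u0 *.
have -> : n.+2%:R = n.+1%:R + 1 :> R by rewrite -[n.+2]addn1 natrD.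
rewrite -(ler_pM2l (_ : 0 < 2 :> R)) // mulrCA.
apply: (le_trans (ler_wpM2l (ltW a0) h)).
rewrite le_eqVlt; apply/orP; left; apply/eqP.
move: a0; set x := n.+1%:R => x0; field.
by rewrite gt_eqF //= ?andbT; apply/andP; split; rewrite gt_eqF //; lra.
Qed.

Lemma stir_gt0 (R : realType) n : 0 < stir R n.+1.
Proof.
by rewrite /stir divr_gt0 ?exprn_gt0 ?divr_gt0 ?expR_gt0 ?ltr0n ?fact_gt0.
Qed.

Lemma stirS (R : realType) n :
  stir R n.+2 = stir R n.+1 * ((1 + n.+1%:R^-1) ^+ n.+1 / expR 1).
Proof.
rewrite /stir [n.+2`!]factS natrM.
have e0 : expR 1 != 0 :> R by rewrite expR_eq0.
have f0 : n.+1`!%:R != 0 :> R by rewrite pnatr_eq0 -lt0n fact_gt0.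
have -> : (n.+2%:R / expR 1) ^+ n.+2 =
   (n.+2%:R / expR 1) * ((1 + n.+1%:R^-1) ^+ n.+1 * (n.+1%:R / expR 1) ^+ n.+1) :> R.
  rewrite exprS -exprMn; congr (_ * _ ^+ _).
  rewrite mulrA [X in _ = X / _]mulrDl mul1r mulVf ?pnatr_eq0 //.
  by congr (_ / _); rewrite -[n.+2]addn1 natrD.
set x := (1 + _) ^+ _; set y := (_ / _) ^+ n.+1.
by field; rewrite e0 f0 -(natrD _ 2 n) pnatr_eq0.
Qed.

Lemma stir_decr (R : realType) n :
  stir R n.+2 ^+ 2 * n.+3%:R <= stir R n.+1 ^+ 2 * n.+2%:R.
Proof.
have s0 := ltW (@stir_gt0 R n); have s1 := ltW (@stir_gt0 R n.+1).
have a0 : (0 : R) < n.+2%:R by rewrite ltr0n.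
set r : R := expR (- (2 * n.+2%:R)^-1).
have le1 : stir R n.+2 <= stir R n.+1 * r.
  rewrite stirS ler_wpM2l // ler_pdivrMr ?expR_gt0 // /r -expRD [X in expR X]addrC.
  exact: expr1V_le_exp.
(* The loss r^2 = e^(-1/(n+2)) pays for the growth of the weight, since e^(1/(n+2)) >= 1 + 1/(n+2) =
   (n+3)/(n+2). *)
have r2 : r ^+ 2 * n.+3%:R <= n.+2%:R.
  rewrite /r -expRM_natl mulrN invfM mulrA mulfV ?pnatr_eq0 // mul1r expRN.
  rewrite mulrC ler_pdivrMr ?expR_gt0 //.
  apply: le_trans (ler_wpM2l (ltW a0) (expR_ge1Dx _)).
  by rewrite mulrDr mulr1 mulfV ?gt_eqF // -[n.+3]addn1 natrD.
apply: (@le_trans _ _ ((stir R n.+1 * r) ^+ 2 * n.+3%:R)).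
  by rewrite ler_wpM2r // lerXn2r // ?nnegrE // mulr_ge0 // expR_ge0.
by rewrite exprMn -mulrA ler_wpM2l // exprn_ge0.
Qed.

Lemma stir_le (R : realType) n :
  stir R n.+1 ^+ 2 * n.+2%:R <= stir R 1 ^+ 2 * 2.
Proof. by elim: n => // n IH; exact: le_trans (stir_decr _ _) IH. Qed.

Lemma cvg_stir (R : realType) : (fun n => stir R n.+1) @ \oo --> (0 : R).
Proof.
set c := stir R 1 ^+ 2 * 2.
have h n : stir R n.+1 <= Num.sqrt (c * n.+1%:R^-1).
  rewrite -[leLHS]gtr0_norm ?stir_gt0 // -sqrtr_sqr ler_wsqrtr //.
  rewrite ler_pdivlMr ?ltr0n //; apply: le_trans (stir_le _ n).
  by rewrite ler_wpM2l ?sqr_ge0 // ler_nat.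
apply: (@squeeze_cvgr _ _ _ _ (fun=> 0) (fun n => Num.sqrt (c * n.+1%:R^-1))).
- by near=> n; rewrite (ltW (stir_gt0 _ _)) h.
- exact: cvg_cst.
- have : (fun n => c * n.+1%:R^-1) @ \oo --> (c * 0 : R).
    by apply: cvgM; [exact: cvg_cst|exact: cvg_harmonic].
  rewrite mulr0 => h1.
  rewrite -[X in _ --> X](sqrtr0 R).
  exact: (cvg_comp _ _ h1 (@sqrt_continuous R 0)).
Unshelve. all: by end_near.
Qed.

(** * The complex exponential series *)

Lemma big_triangle (M : nmodType) (F : nat -> nat -> M) (n : nat) :
  \sum_(k < n) \sum_(i < k.+1) F i (k - i)%N =
  \sum_(i < n) \sum_(j < n - i) F i j.
Proof.
elim: n => [|n IH]; first by rewrite !big_ord0.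
rewrite big_ord_recr IH [RHS]big_ord_recr /= subSnn big_ord1.
rewrite big_ord_recr /= subnn addrA -big_split /=; congr (_ + _).
by apply: eq_bigr => i _; rewrite (subSn (ltnW (ltn_ord i))) big_ord_recr.
Qed.

Definition expS (K : fieldType) (z : K) (n : nat) : K :=
  \sum_(k < n) z ^+ k / k`!%:R.

Lemma expr_div_factD (K : numFieldType) (x y : K) k :
  (x + y) ^+ k / k`!%:R =
  \sum_(i < k.+1) (x ^+ i / i`!%:R) * (y ^+ (k - i) / (k - i)`!%:R).
Proof.
rewrite addrC exprDn mulr_suml; apply: eq_bigr => i _.
have ik : (i <= k)%N by rewrite -ltnS.
have fn j : j`!%:R != 0 :> K by rewrite pnatr_eq0 -lt0n fact_gt0.
rewrite -mulr_natr -(bin_fact ik) !natrM.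
field.
by rewrite !fn pnatr_eq0 -lt0n bin_gt0 ik.
Qed.

(** The product runs over the square i, j < n. By the binomial formula the sums for x + y run over
    the triangle i + j < n. The complement of the triangle remains. *)
Lemma expSM_sub (K : numFieldType) (x y : K) n :
  expS x n * expS y n - expS (x + y) n =
  \sum_(i < n) \sum_(j < n | (n - i <= j)%N)
    (x ^+ i / i`!%:R) * (y ^+ j / j`!%:R).
Proof.
rewrite /expS [X in _ - X](eq_bigr _ (fun (k : 'I_n) _ => expr_div_factD x y k)).
rewrite (big_triangle (fun i j => (x ^+ i / i`!%:R) * (y ^+ j / j`!%:R))).
rewrite mulr_suml -sumrB; apply: eq_bigr => i _.
rewrite mulr_sumr [X in X - _](bigID (fun j : 'I_n => (j < n - i)%N)) /=.
rewrite (big_ord_widen_cond n predT (fun j => x ^+ i / i`!%:R * (y ^+ j / j`!%:R))) ?leq_subr //=.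
rewrite addrAC subrr add0r; apply: eq_bigl => j; by rewrite -leqNgt.
Qed.

Lemma norm_expSM_sub (K : numFieldType) (x y : K) n :
  `|expS x n * expS y n - expS (x + y) n| <=
  expS `|x| n * expS `|y| n - expS (`|x| + `|y|) n.
Proof.
rewrite !expSM_sub; apply: le_trans (ler_norm_sum _ _ _) _.
apply: ler_sum => i _; apply: le_trans (ler_norm_sum _ _ _) _.
by apply: ler_sum => j _; rewrite !(normrM, normfV, normrX) !normr_nat.
Qed.

Definition expC (R : realType) (z : R[i]) : R[i] :=
  (expR (complex.Re z))%:C *
    (cos (complex.Im z) +i* sin (complex.Im z))%C.

(* Stated on components because R[i] carries no topology here. *)
Definition cvgC (R : realType) (u : nat -> R[i]) (l : R[i]) : Prop :=
  (fun n => complex.Re (u n)) @ \oo --> complex.Re l /\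
  (fun n => complex.Im (u n)) @ \oo --> complex.Im l.

Lemma cvgC_cst (R : realType) (l : R[i]) : cvgC (fun=> l) l.
Proof. by split; exact: cvg_cst. Qed.

Lemma cvgCD (R : realType) (u v : nat -> R[i]) a b :
  cvgC u a -> cvgC v b -> cvgC (fun n => u n + v n) (a + b).
Proof.
case=> ur ui [vr vi]; split.
  rewrite (_ : complex.Re _ = complex.Re a + complex.Re b); last by case: a b {ur ui vr vi} => ? ? [].
  rewrite (_ : (fun=> _) = (fun n => complex.Re (u n) + complex.Re (v n))); first exact: cvgD.
  by apply/funext => n; case: (u n) (v n) => ? ? [].
rewrite (_ : complex.Im _ = complex.Im a + complex.Im b); last by case: a b {ur ui vr vi} => ? ? [].
rewrite (_ : (fun=> _) = (fun n => complex.Im (u n) + complex.Im (v n))); first exact: cvgD.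
by apply/funext => n; case: (u n) (v n) => ? ? [].
Qed.

Lemma cvgCM (R : realType) (u v : nat -> R[i]) a b :
  cvgC u a -> cvgC v b -> cvgC (fun n => u n * v n) (a * b).
Proof.
case=> ur ui [vr vi]; split.
  rewrite (_ : complex.Re _ = complex.Re a * complex.Re b - complex.Im a * complex.Im b); last by case: a b {ur ui vr vi} => ? ? [].
  rewrite (_ : (fun=> _) = (fun n => complex.Re (u n) * complex.Re (v n) - complex.Im (u n) * complex.Im (v n))).
    by apply: cvgB; exact: cvgM.
  by apply/funext => n; case: (u n) (v n) => ? ? [].
rewrite (_ : complex.Im _ = complex.Re a * complex.Im b + complex.Im a * complex.Re b); last by case: a b {ur ui vr vi} => ? ? [].
rewrite (_ : (fun=> _) = (fun n => complex.Re (u n) * complex.Im (v n) + complex.Im (u n) * complex.Re (v n))).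
  by apply: cvgD; exact: cvgM.
by apply/funext => n; case: (u n) (v n) => ? ? [].
Qed.

Lemma cvgC_sum (R : realType) (I : Type) (r : seq I) (u : I -> nat -> R[i]) (a : I -> R[i]) :
  (forall i, cvgC (u i) (a i)) ->
  cvgC (fun n => \sum_(i <- r) u i n) (\sum_(i <- r) a i).
Proof.
move=> h; elim: r => [|i r IH].
  by rewrite big_nil; under eq_fun do rewrite big_nil; exact: cvgC_cst.
by rewrite big_cons; under eq_fun do rewrite big_cons; exact: cvgCD.
Qed.

Lemma cvgC_norm (R : realType) (u : nat -> R[i]) (e : nat -> R) :
  (forall n, `|u n| <= (e n)%:C) -> e @ \oo --> (0 : R) -> cvgC u 0.
Proof.
move=> h e0.
have hr n : `|complex.Re (u n)| <= e n.
  by rewrite -lecR; exact: le_trans (normc_ge_Re _) (h n).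
have hi n : `|complex.Im (u n)| <= e n.
  rewrite -lecR; apply: le_trans _ (h n).
  rewrite normc_def lecR -sqrtr_sqr ler_wsqrtr // lerDr; exact: sqr_ge0.
have e0N : - e @ \oo --> (0 : R) by rewrite -oppr0; exact: cvgN.
split; apply: squeeze_cvgr e0N e0; near=> n => /=.
- by rewrite -ler_norml hr.
- by rewrite -ler_norml hi.
Unshelve. all: by end_near.
Qed.

Lemma cvgC_shift (R : realType) (u : nat -> R[i]) l k :
  cvgC u l <-> cvgC (fun n => u (n + k)%N) l.
Proof.
have h (f : nat -> R) (a : R) : f @ \oo --> a <-> (fun n => f (n + k)%N) @ \oo --> a.
  by rewrite cvg_shiftn.
by split=> -[hr hi]; split; apply/(h (fun n => _ (u n))).
Qed.

Lemma cvg_expS (R : realType) (x : R) : expS x @ \oo --> expR x.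
Proof.
rewrite (_ : expS x = series (exp_coeff x)); first exact: is_cvg_series_exp_coeff.
by apply/funext => n; rewrite /series /= /expS big_mkord.
Qed.

Lemma cvgC_expS (R : realType) (z : R[i]) : cvgC (expS z) (expC z).
Proof.
case: z => a b.
have expSr (x : R) n : expS x%:C n = (expS x n)%:C.
  by rewrite /expS rmorph_sum /=; apply: eq_bigr => k _; rewrite rmorphM fmorphV rmorph_nat rmorphXn.
have Ha : cvgC (expS a%:C) (expR a)%:C.
  split => /=; last first.
    by under eq_fun do rewrite expSr; exact: cvg_cst.
  by under eq_fun do rewrite expSr; exact: cvg_expS.
have i2 k : ('i%C : R[i]) ^+ k = if odd k then ((-1) ^+ k./2)%:C * 'i%C else ((-1) ^+ k./2)%:C.
  rewrite -{1}(odd_double_half k) exprD -mul2n exprM sqr_i rmorphXn rmorphN1.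
  by case: (odd k); rewrite ?expr0 ?expr1 ?mul1r // mulrC.
(* [cos_coeff] vanishes at odd indices and [sin_coeff] at even ones, so each term of the series is
   purely real or purely imaginary. *)
have term k : (b%:C * 'i%C) ^+ k / k`!%:R = (cos_coeff b k +i* sin_coeff b k)%C.
  rewrite exprMn i2 /cos_coeff /sin_coeff /= -exprnP -[k`!%:R](rmorph_nat (real_complex R)).
  rewrite -fmorphV -rmorphXn /=.
  have h2 : odd k -> k.-1./2 = k./2 by case: k => //= k ok; rewrite uphalf_half (negbTE ok).
  case ok: (odd k) => /=; [rewrite h2 // | ].
    by apply/eqP; rewrite eq_complex /=; apply/andP; split; apply/eqP; ring.
  by apply/eqP; rewrite eq_complex /=; apply/andP; split; apply/eqP; ring.
have ReS n (F : nat -> R[i]) : complex.Re (\sum_(k < n) F k) = \sum_(k < n) complex.Re (F k).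
  by elim: n => [|n IH]; rewrite ?big_ord0 // !big_ord_recr /= -IH; case: (\sum_(_ < _) _) (F n) => ? ? [].
have ImS n (F : nat -> R[i]) : complex.Im (\sum_(k < n) F k) = \sum_(k < n) complex.Im (F k).
  by elim: n => [|n IH]; rewrite ?big_ord0 // !big_ord_recr /= -IH; case: (\sum_(_ < _) _) (F n) => ? ? [].
have Hb : cvgC (expS (b%:C * 'i%C)) (cos b +i* sin b)%C.
  split.
    rewrite (_ : (fun=> _) = series (cos_coeff b)).
      by rewrite /= unlock; exact: is_cvg_series_cos_coeff.
    by apply/funext => n; rewrite /expS (ReS n (fun k => (b%:C * 'i%C) ^+ k / k`!%:R)) /series /= big_mkord; apply: eq_bigr => k _; rewrite term.
  rewrite (_ : (fun=> _) = series (sin_coeff b)).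
    by rewrite /= unlock; exact: is_cvg_series_sin_coeff.
  by apply/funext => n; rewrite /expS (ImS n (fun k => (b%:C * 'i%C) ^+ k / k`!%:R)) /series /= big_mkord; apply: eq_bigr => k _; rewrite term.
have -> : (a +i* b)%C = a%:C + b%:C * 'i%C by simpc.
have -> : expC (a%:C + b%:C * 'i%C) = (expR a)%:C * (cos b +i* sin b)%C + (-1) * 0.
  by rewrite mulr0 addr0 /expC /= !(mulr0, mul0r, addr0, add0r, subr0, mulr1).
set x := a%:C; set y := b%:C * 'i%C.
(* The Cauchy product defect for the real series of moduli dominates the
   complex one, and tends to 0 because expR is multiplicative. *)
rewrite (_ : expS _ = fun n => expS x n * expS y n + (-1) * (expS x n * expS y n - expS (x + y) n)); last first.
  by apply/funext => n; rewrite mulN1r opprB [RHS]addrC subrK.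
apply: cvgCD; first exact: cvgCM.
apply: cvgCM; first exact: cvgC_cst.
have nr (r : R) : `|r%:C| = `|r|%:C.
  by rewrite normc_def /= expr0n /= addr0 sqrtr_sqr.
have yn : `|y| = `|b|%:C.
  by rewrite /y normrM nr (normc_def 'i%C) /= expr0n /= add0r expr1n sqrtr1 mulr1.
have xn : `|x| = `|a|%:C by rewrite nr.
apply: (@cvgC_norm R _ (fun n => expS `|a| n * expS `|b| n - expS (`|a| + `|b|) n)).
  move=> n; rewrite rmorphB rmorphM /= -!expSr.
  have -> : (`|a| + `|b|)%:C = `|x| + `|y| by rewrite xn yn rmorphD.
  by rewrite -xn -yn; exact: norm_expSM_sub.
rewrite -(subrr (expR (`|a| + `|b|))) {1}expRD.
by apply: cvgB; [apply: cvgM|]; exact: cvg_expS.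
Qed.

(** * Generalized eigenvectors *)

(** Plays two parts: a partial sum of e^(tN) u with k terms, and the exact value of e^(tN) u once
    N^k u = 0. *)
Definition Qpoly (K : numFieldType) (m : nat) (N : 'M[K]_m) (t : K) (k : nat)
    (u : 'cV[K]_m) : 'cV[K]_m :=
  \sum_(j < k) (t ^+ j / j`!%:R) *: (N ^+ j *m u).

Lemma expmx_mul0_le (K : pzRingType) (m : nat) (N : 'M[K]_m) (u : 'cV[K]_m) k j :
  N ^+ k *m u = 0 -> (k <= j)%N -> N ^+ j *m u = 0.
Proof.
by move=> h /subnK <-; rewrite exprD -mulmxE -mulmxA h mulmx0.
Qed.

(** N commutes with the scalar c, so the binomial formula gives a triangular double sum; nilpotency
    on u cuts the index of N at k, and each inner sum is a partial sum of e^(tc). As the identity is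
    finite, only scalar limits remain to be taken. *)
Lemma taylor_nilpotentE (K : numFieldType) (m : nat) (N : 'M[K]_m) (c t : K)
    (u : 'cV[K]_m) k n :
  N ^+ k *m u = 0 -> (k <= n)%N ->
  Qpoly (N + c%:M) t n u =
  \sum_(j < k) expS (t * c) (n - j) *: ((t ^+ j / j`!%:R) *: (N ^+ j *m u)).
Proof.
move=> Nu kn.
pose F j l := ((t * c) ^+ l / l`!%:R) *: ((t ^+ j / j`!%:R) *: (N ^+ j *m u)).
have E (i : nat) : (t ^+ i / i`!%:R) *: ((N + c%:M) ^+ i *m u) =
    \sum_(j < i.+1) F j (i - j)%N.
  have cN : GRing.comm c%:M N by rewrite /GRing.comm -!mulmxE scalar_mxC.
  rewrite [N + _]addrC exprDn_comm // mulmx_suml scaler_sumr.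
  apply: eq_bigr => j _; rewrite /F.
  have ji : (j <= i)%N by rewrite -ltnS.
  have fn l : l`!%:R != 0 :> K by rewrite pnatr_eq0 -lt0n fact_gt0.
  have -> : (c%:M : 'M[K]_m) ^+ (i - j) = (c ^+ (i - j))%:M.
    by elim: (i - j)%N => [|l IH]; rewrite ?expr0 // exprS IH -mulmxE -scalar_mxM -exprS.
  rewrite -mulmxE mul_scalar_mx -[_ *+ 'C(_, _)]scaler_nat scalerA -scalemxAl !scalerA; congr (_ *: _).
  have -> : t ^+ i = t ^+ (i - j) * t ^+ j by rewrite -exprD subnK.
  rewrite exprMn -(bin_fact ji) !natrM.
  field.
  by rewrite !fn pnatr_eq0 -lt0n bin_gt0 ji.
rewrite /Qpoly (eq_bigr _ (fun (i : 'I_n) _ => E i)) (big_triangle F).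
rewrite (big_ord_widen n (fun j => expS (t * c) (n - j) *: ((t ^+ j / j`!%:R) *: (N ^+ j *m u)))) //.
rewrite [RHS]big_mkcond /=; apply: eq_bigr => j _; rewrite /F -scaler_suml.
by case: ltnP => // kj; rewrite (expmx_mul0_le Nu kj) !scaler0.
Qed.

(** On the kernel of (B - mu)^k, B - r is the nonzero scalar mu - r plus a nilpotent map, hence
    invertible. *)
Lemma GE_preimage (K : fieldType) (m : nat) (B : 'M[K]_m) (mu r : K) k (w : 'cV[K]_m) :
  mu != r -> (B - mu%:M) ^+ k *m w = 0 ->
  exists2 w' : 'cV[K]_m, (B - mu%:M) ^+ k *m w' = 0 & (B - r%:M) *m w' = w.
Proof.
move=> mr; elim: k w => [|k IH] w.
  by rewrite expr0 mul1mx => ->; exists 0; rewrite mulmx0.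
rewrite exprSr -mulmxE -mulmxA => /IH [w1 h1 h2].
(* With (B - r) w1 = (B - mu) w from the induction, (B - r) (w - w1) = (mu - r) w. *)
exists ((mu - r)^-1 *: (w - w1)).
  rewrite -scalemxAr mulmxBr -mulmxA -{1}h2.
  have cm : GRing.comm ((B - mu%:M) ^+ k) (B - mu%:M) by apply: commr_sym; apply: commrX; exact: commr_refl.
  have cm2 : GRing.comm (B - mu%:M) (B - r%:M).
    rewrite /GRing.comm -!mulmxE !(mulmxBl, mulmxBr) (scalar_mxC mu) (scalar_mxC r) -!scalar_mxM [mu * r]mulrC.
    by rewrite !opprB addrACA [RHS]addrACA; congr (_ + _); exact: addrC.
  have cm3 : GRing.comm ((B - mu%:M) ^+ k) (B - r%:M) by apply: commr_sym; apply: commrX; exact: commr_sym.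
  rewrite mulmxA mulmxE cm3 -mulmxE -mulmxA h1 mulmx0 mulmxE cm -mulmxE -mulmxA h1 mulmx0 subr0.
  by rewrite scaler0.
rewrite -scalemxAr mulmxBr h2 -mulmxBl opprB [X in X *m _]addrC addrA subrK.
rewrite -raddfB /= mul_scalar_mx scalerA mulVf ?scale1r // subr_eq0 //.
Qed.

(** The exponent k mu may be 0, which forces z mu = 0; total functions k and z thus always have a
    trivial value to take. *)
Definition gdecomp (K : fieldType) (m : nat) (B : 'M[K]_m) (S : seq K) (v : 'cV[K]_m) :=
  exists k : K -> nat, exists z : K -> 'cV[K]_m,
    (forall mu, (B - mu%:M) ^+ k mu *m z mu = 0) /\ v = \sum_(mu <- S) z mu.

(* B - r is onto each generalized eigenspace with mu <> r, so it suffices to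
   correct v by preimages of those components; the rest lies in the
   generalized eigenspace of r. *)
Lemma gdecomp_step (K : fieldType) (m : nat) (B : 'M[K]_m) (S : seq K) r v :
  uniq S -> r \in S -> gdecomp B S ((B - r%:M) *m v) -> gdecomp B S v.
Proof.
move=> uS rS [k [z [hz e]]].
have /choice [w' hw'] : forall mu, exists w' : 'cV[K]_m, mu != r ->
    (B - mu%:M) ^+ k mu *m w' = 0 /\ (B - r%:M) *m w' = z mu.
  move=> mu; have [->|mr] := eqVneq mu r; first by exists 0.
  by have [w' ? ?] := GE_preimage mr (hz mu); exists w'.
pose vr := v - \sum_(mu <- S | mu != r) w' mu.
exists (fun mu => if mu == r then (k r).+1 else k mu).
exists (fun mu => if mu == r then vr else w' mu); split.
  move=> mu; case: eqVneq => [->|mr]; last by have [] := hw' _ mr.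
  rewrite exprSr -mulmxE -mulmxA /vr mulmxBr e mulmx_sumr.
  rewrite (bigD1_seq r) //= [X in _ + _ - X](eq_bigr z); last by move=> nu /hw' [].
  by rewrite addrK hz.
rewrite (bigD1_seq r) //= eqxx [X in _ + X](eq_bigr w'); last by move=> mu /negbTE ->.
by rewrite /vr subrK.
Qed.

(** The factors X - r are peeled off one at a time. A root may recur in [rs] but not in [S]: each
    occurrence raises the exponent attached to that root. *)
Lemma gdecomp_prod (K : fieldType) (m : nat) (B : 'M[K]_m.+1) (S rs : seq K) v :
  uniq S -> {subset rs <= S} ->
  horner_mx B (\prod_(r <- rs) ('X - r%:P)) *m v = 0 -> gdecomp B S v.
Proof.
move=> uS; elim: rs v => [|r rs IH] v sub.
  rewrite big_nil rmorph1 mul1mx => ->.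
  by exists (fun=> 0), (fun=> 0); split=> [mu|]; rewrite ?mulmx0 // big1.
rewrite big_cons mulrC rmorphM /= -mulmxE -mulmxA rmorphB /= horner_mx_X horner_mx_C => h.
apply: (@gdecomp_step _ _ _ _ r) => //; first by rewrite sub ?mem_head.
by apply: IH h => x xrs; rewrite sub // inE xrs orbT.
Qed.

Lemma gdecomp_exists (K : closedFieldType) (m : nat) (B : 'M[K]_m.+1) :
  exists2 S : seq K, uniq S /\ (forall mu, (mu \in S) = eigenvalue B mu) &
    forall v, gdecomp B S v.
Proof.
have [rs E] := closed_field_poly_normal (char_poly B).
move: E; rewrite (monicP (char_poly_monic B)) scale1r => E.
exists (undup rs).
  by split; [exact: undup_uniq|move=> mu; rewrite mem_undup eigenvalue_root_char E root_prod_XsubC].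
move=> v; apply: (@gdecomp_prod _ _ _ _ rs); first exact: undup_uniq.
  by move=> x; rewrite mem_undup.
by rewrite -E Cayley_Hamilton mul0mx.
Qed.

(* char_poly B = q * (X - a)^k with q coprime to every (X - a)^j. *)
Lemma expmx_kernel_stable (K : fieldType) (m : nat) (B : 'M[K]_m.+1) (a : K) :
  exists k, forall j y, (B - a%:M) ^+ j *m y = 0 :> 'cV[K]_m.+1 ->
    (B - a%:M) ^+ k *m y = 0.
Proof.
have [k [q /implyP hq E]] := multiplicity_XsubC (char_poly B) a.
exists k => j y h.
have hX i : horner_mx B (('X - a%:P) ^+ i) = (B - a%:M) ^+ i.
  by rewrite rmorphXn rmorphB /= horner_mx_X horner_mx_C.
have qa := hq (monic_neq0 (char_poly_monic B)).
have : coprimep (('X - a%:P) ^+ j) q by rewrite coprimep_sym coprimep_expr // coprimep_XsubC.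
move=> /Bezout_eq1_coprimepP [[u1 u2] /= bez].
have {1}-> : y = horner_mx B u2 *m (horner_mx B q *m y).
  rewrite -[LHS]mul1mx -[1%:M](rmorph1 (horner_mx B)) -bez rmorphD !rmorphM /= hX.
  by rewrite mulmxDl -!mulmxE -mulmxA h mulmx0 add0r mulmxA.
rewrite -hX !mulmxA !mulmxE -!rmorphM.
have -> : ('X - a%:P) ^+ k * u2 * q = u2 * char_poly B by rewrite E; ring.
by rewrite rmorphM /= Cayley_Hamilton mulr0 mul0mx.
Qed.

(** * The Frobenius norm *)

(** Lagrange's identity: twice the difference of the two sides is the double sum of (f_i g_j - f_j
    g_i)^2. *)
Lemma sum_CauchySchwarz (R : realDomainType) (I : finType) (f g : I -> R) :
  (\sum_i f i * g i) ^+ 2 <= (\sum_i f i ^+ 2) * (\sum_i g i ^+ 2).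
Proof.
suff : 0 <= (\sum_i f i ^+ 2) * (\sum_i g i ^+ 2)
          + (\sum_i g i ^+ 2) * (\sum_i f i ^+ 2)
          - 2 * ((\sum_i f i * g i) * (\sum_i f i * g i)).
  set a := \sum_i f i ^+ 2; set c := \sum_i g i ^+ 2; set b := \sum_i _; nra.
rewrite !big_distrlr mulr_sumr -!big_split -sumrB /=; apply: sumr_ge0 => i _.
rewrite mulr_sumr -!big_split -sumrB /=; apply: sumr_ge0 => j _.
have := sqr_ge0 (f i * g j - f j * g i); nra.
Qed.

Section Frobenius.
Variables (R : realType) (m : nat).
Implicit Types M N P A : 'M[R]_m.

Lemma mdotE M N : mdot M N = \sum_(p : 'I_m * 'I_m) M p.2 p.1 * N p.2 p.1.
Proof.
rewrite /mdot /vdot -(pair_bigA _ (fun i j => M j i * N j i)) /=.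
by apply: eq_bigr => i _; apply: eq_bigr => j _; rewrite !mxE.
Qed.

Lemma mdotDl M N P : mdot (M + N) P = mdot M P + mdot N P.
Proof. by rewrite !mdotE -big_split; apply: eq_bigr => p _; rewrite mxE mulrDl. Qed.

Lemma mdotC M N : mdot M N = mdot N M.
Proof. by rewrite !mdotE; apply: eq_bigr => p _; rewrite mulrC. Qed.

Lemma mdotZl a M N : mdot (a *: M) N = a * mdot M N.
Proof. by rewrite !mdotE mulr_sumr; apply: eq_bigr => p _; rewrite mxE mulrA. Qed.

Lemma mdotBl M N P : mdot (M - N) P = mdot M P - mdot N P.
Proof. by rewrite -scaleN1r mdotDl mdotZl mulN1r. Qed.

Lemma mdotBr M N P : mdot P (M - N) = mdot P M - mdot P N.
Proof. by rewrite mdotC mdotBl !(mdotC _ P). Qed.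

Lemma mdotZr a M N : mdot M (a *: N) = a * mdot M N.
Proof. by rewrite mdotC mdotZl mdotC. Qed.

Lemma mdot_ge0 M : 0 <= mdot M M.
Proof. by rewrite mdotE; apply: sumr_ge0 => p _; rewrite -expr2 sqr_ge0. Qed.

Lemma mnorm_ge0 M : 0 <= mnorm M. Proof. exact: sqrtr_ge0. Qed.

Lemma mnorm_sqr M : mnorm M ^+ 2 = mdot M M.
Proof. by rewrite /mnorm sqr_sqrtr ?mdot_ge0. Qed.

Lemma mdot_le M N : `|mdot M N| <= mnorm M * mnorm N.
Proof.
rewrite -(@ler_pXn2r _ 2) // ?nnegrE ?mulr_ge0 ?mnorm_ge0 //.
rewrite exprMn !mnorm_sqr !mdotE real_normK ?num_real //.
exact: sum_CauchySchwarz.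
Qed.

Lemma ler_mnormD M N : mnorm (M + N) <= mnorm M + mnorm N.
Proof.
rewrite -(@ler_pXn2r _ 2) // ?nnegrE ?addr_ge0 ?mnorm_ge0 //.
rewrite sqrrD !mnorm_sqr mdotDl ![mdot _ (M + N)]mdotC !mdotDl (mdotC N M).
have := mdot_le M N; have := ler_norm (mdot M N); lra.
Qed.

Lemma mnormZ a M : mnorm (a *: M) = `|a| * mnorm M.
Proof.
by rewrite /mnorm mdotZl mdotZr mulrA -expr2 sqrtrM ?sqr_ge0 // sqrtr_sqr.
Qed.

Lemma mnormN M : mnorm (- M) = mnorm M.
Proof. by rewrite -scaleN1r mnormZ normrN normr1 mul1r. Qed.

Lemma mnorm_distrC M N : mnorm (M - N) = mnorm (N - M).
Proof. by rewrite -mnormN opprB. Qed.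

Lemma mnorm0 : mnorm (0 : 'M[R]_m) = 0.
Proof. by rewrite -(scale0r 0) mnormZ normr0 mul0r. Qed.

Lemma ler_mnormB M N : mnorm M - mnorm N <= mnorm (M - N).
Proof. by rewrite lerBlDr -{1}(subrK N M) ler_mnormD. Qed.

Lemma ler_mnorm_dist M N : `|mnorm M - mnorm N| <= mnorm (M - N).
Proof.
rewrite ler_norml ler_mnormB andbT lerNl opprB mnorm_distrC; exact: ler_mnormB.
Qed.

Lemma ler_mnorm_dist3 M N P : mnorm (M - P) <= mnorm (M - N) + mnorm (N - P).
Proof. by rewrite -[M - P](subrKA N) ler_mnormD. Qed.

Lemma ler_mnorm_sum (I : Type) (r : seq I) (F : I -> 'M[R]_m) :
  mnorm (\sum_(i <- r) F i) <= \sum_(i <- r) mnorm (F i).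
Proof.
elim: r => [|i r IH]; first by rewrite !big_nil mnorm0.
by rewrite !big_cons; apply: le_trans (ler_mnormD _ _) _; rewrite lerD2l.
Qed.

Lemma mnorm_le_entries M (c : R) :
  (forall i j, `|M i j| <= c) -> mnorm M <= m%:R * c.
Proof.
(* For m = 0 the sign of c is unknown, but both sides vanish. *)
move=> h; case: (posnP m) => [m0|m0].
  rewrite /mnorm mdotE big1 ?sqrtr0 ?m0 ?mul0r // => -[[i im]]; exfalso.
  by rewrite m0 in im.
have c0 : 0 <= c by apply: le_trans (h (Ordinal m0) (Ordinal m0)).
rewrite -(@ler_pXn2r _ 2) // ?nnegrE ?mulr_ge0 ?mnorm_ge0 //.
rewrite mnorm_sqr mdotE.
apply: (@le_trans _ _ (\sum_(p : 'I_m * 'I_m) c ^+ 2)).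
  apply: ler_sum => p _; rewrite -expr2 -real_normK ?num_real //.
  by rewrite lerXn2r ?nnegrE.
by rewrite sumr_const card_prod card_ord -[leLHS]mulr_natl natrM exprMn (expr2 m%:R).
Qed.

Lemma mnorm_mulmx M N : mnorm (M *m N) <= mnorm M * mnorm N.
Proof.
rewrite -(@ler_pXn2r _ 2) // ?nnegrE ?mulr_ge0 ?mnorm_ge0 //.
rewrite exprMn !mnorm_sqr !mdotE.
rewrite -(pair_bigA _ (fun i j => (M *m N) j i * (M *m N) j i)) /=.
rewrite -(pair_bigA _ (fun i j => M j i * M j i)) /=.
rewrite -(pair_bigA _ (fun i j => N j i * N j i)) /=.
rewrite [X in _ <= X * _]exchange_big mulrC big_distrlr /=.
apply: ler_sum => i _; apply: ler_sum => j _.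
rewrite -expr2 mxE mulrC.
by apply: sum_CauchySchwarz.
Qed.

Lemma mnorm_normalize_le1 M : mnorm (normalize M) <= 1.
Proof.
rewrite mnormZ ger0_norm ?invr_ge0 ?mnorm_ge0 //.
by have [->|h] := eqVneq (mnorm M) 0; rewrite ?mulr0 ?mulVf.
Qed.

Lemma mnorm_normalize M : 0 < mnorm M -> mnorm (normalize M) = 1.
Proof.
move=> h; by rewrite mnormZ ger0_norm ?invr_ge0 ?mnorm_ge0 // mulVf ?gt_eqF.
Qed.

Lemma normalizeZ (a : R) M : 0 < a -> normalize (a *: M) = normalize M.
Proof.
move=> a0; rewrite /normalize mnormZ gtr0_norm // scalerA invfM mulrAC.
by rewrite mulVf ?mul1r // gt_eqF.
Qed.

(** Split the difference as (1/|M| - 1/|N|) M + (M - N)/|N|. The first term has norm ||N| - |M|| /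
    |N|, or 0 when M = 0, so each term contributes at most |M - N| / |N|. *)
Lemma normalize_lipschitz M N : 0 < mnorm N ->
  mnorm (normalize M - normalize N) <= 2 * (mnorm (M - N) / mnorm N).
Proof.
move=> N0.
have -> : normalize M - normalize N =
    ((mnorm M)^-1 - (mnorm N)^-1) *: M + (mnorm N)^-1 *: (M - N).
  by rewrite scalerBl scalerBr addrA subrK.
apply: le_trans (ler_mnormD _ _) _; rewrite mulr_natl mulr2n !mnormZ.
have iN0 : 0 < (mnorm N)^-1 by rewrite invr_gt0.
rewrite [X in _ + X * _]gtr0_norm // [X in _ + X]mulrC lerD2r.
have [->|h] := eqVneq (mnorm M) 0.
  by rewrite mulr0 mulr_ge0 ?mnorm_ge0 // ltW.
have M0 : 0 < mnorm M by rewrite lt_def h mnorm_ge0.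
rewrite -{2}[mnorm M]gtr0_norm // -normrM mulrBl mulVf //.
rewrite -[X in X - _](mulVf (lt0r_neq0 N0)) -mulrBr normrM gtr0_norm // mulrC.
by rewrite ler_wpM2r ?(ltW iN0) // distrC ler_mnorm_dist.
Qed.

Lemma mdot_mul_lipschitz A M N : mnorm M <= 1 -> mnorm N <= 1 ->
  `|mdot (A *m M) M - mdot (A *m N) N| <= 2 * mnorm A * mnorm (M - N).
Proof.
move=> M1 N1.
have -> : mdot (A *m M) M - mdot (A *m N) N =
    mdot (A *m (M - N)) M + mdot (A *m N) (M - N).
  by rewrite mulmxBr mdotBl mdotBr addrA subrK.
apply: le_trans (ler_normD _ _) _.
have h1 := le_trans (mdot_le (A *m (M - N)) M) (ler_wpM2r (mnorm_ge0 M) (mnorm_mulmx A (M - N))).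
have h2 := le_trans (mdot_le (A *m N) (M - N)) (ler_wpM2r (mnorm_ge0 (M - N)) (mnorm_mulmx A N)).
apply: le_trans (lerD h1 h2) _.
have a0 := mnorm_ge0 A; have d0 := mnorm_ge0 (M - N).
have : mnorm A * mnorm (M - N) * mnorm M <= mnorm A * mnorm (M - N) by rewrite ler_piMr // mulr_ge0.
have : mnorm A * mnorm N * mnorm (M - N) <= mnorm A * mnorm (M - N) by rewrite ler_wpM2r // ler_piMr.
lra.
Qed.

(** The factor M stays because the Frobenius norm of the identity is sqrt m: for m > 1 the bound
    |A^k| <= |A|^k already fails at k = 0. *)
Lemma mnorm_expmx_mul A M k : mnorm (A ^+ k *m M) <= mnorm A ^+ k * mnorm M.
Proof.
elim: k => [|k IH]; first by rewrite !expr0 mul1mx mul1r.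
rewrite !exprS -mulmxE -mulmxA -mulrA; apply: le_trans (mnorm_mulmx _ _) _.
by rewrite ler_wpM2l ?mnorm_ge0.
Qed.
End Frobenius.

(** The binomial coefficient is at least 1, so (n + k)! >= n! k!, and the tail is dominated by its
    first term times an exponential series. *)
Lemma expS_tail (R : realType) (x : R) (n p : nat) : 0 <= x ->
  \sum_(k < p) x ^+ (n + k) / (n + k)`!%:R <= x ^+ n / n`!%:R * expR x.
Proof.
move=> x0; apply: (@le_trans _ _ (x ^+ n / n`!%:R * expS x p)).
  rewrite /expS mulr_sumr; apply: ler_sum => k _.
  rewrite exprD mulrACA -invfM -natrM ler_wpM2l ?mulr_ge0 ?exprn_ge0 //.
  rewrite lef_pV2 ?posrE ?ltr0n ?muln_gt0 ?fact_gt0 // ler_nat.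
  rewrite -(bin_fact (leq_addr k n)) addKn leq_pmull // bin_gt0 leq_addr //.
rewrite ler_wpM2l ?divr_ge0 ?exprn_ge0 //.
rewrite (_ : expS x p = series (exp_coeff x) p); last first.
  by rewrite /series /= /expS big_mkord.
rewrite /expR; apply: nondecreasing_cvgn_le (is_cvg_series_exp_coeff x) p.
apply/nondecreasing_seqP => k; rewrite /series /= big_nat_recr //= lerDl.
exact: exp_coeff_ge0.
Qed.

Lemma Xn_diff (R : realType) (m : nat) (A V : 'M[R]_m) (t : R) n p : 0 <= t ->
  mnorm V = 1 ->
  mnorm (Xn A V (n + p) t - Xn A V n t) <=
    (t * mnorm A) ^+ n.+1 / n.+1`!%:R * expR (t * mnorm A).
Proof.
move=> t0 V1.
rewrite /Xn -(addSn n p) big_split_ord /= addrAC subrr add0r.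
apply: le_trans (ler_mnorm_sum _ _) _.
apply: le_trans (expS_tail n.+1 p (mulr_ge0 t0 (mnorm_ge0 A))).
apply: ler_sum => k _; rewrite mnormZ ger0_norm ?divr_ge0 ?exprn_ge0 //.
rewrite exprMn mulrAC; apply: ler_wpM2r; first by rewrite invr_ge0.
by apply: ler_wpM2l; rewrite ?exprn_ge0 // -[leRHS]mulr1 -V1 mnorm_expmx_mul.
Qed.

(** * The matrix exponential *)

Lemma cvg_mx_entries (R : realType) (m : nat) (u : nat -> 'M[R]_m) (L : 'M[R]_m) :
  (forall i j, (fun n => u n i j) @ \oo --> L i j) -> u @ \oo --> L.
Proof.
move=> h; apply/cvg_ballP => e e0.
have : \forall n \near \oo, forall i, forall j, ball (L i j) e (u n i j).
  apply: filter_forall => i; apply: filter_forall => j.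
  by have /cvg_ballP := h i j; exact.
by apply: filterS => n hn; split.
Qed.

Lemma cvg_sumr (R : realType) (I : Type) (r : seq I) (u : I -> nat -> R) (a : I -> R) :
  (forall i, u i @ \oo --> a i) ->
  (fun n => \sum_(i <- r) u i n) @ \oo --> \sum_(i <- r) a i.
Proof.
move=> h; elim: r => [|i r IH].
  by rewrite big_nil; under eq_fun do rewrite big_nil; exact: cvg_cst.
by rewrite big_cons; under eq_fun do rewrite big_cons; exact: cvgD.
Qed.

(** Applied to basis vectors, the hypothesis gives the convergence of every entry. Hence [limn] is a
    genuine limit and not a default value, and F is identified with it. *)
Lemma cvg_taylor_mulmx (R : realType) (m : nat) (B : 'M[R]_m) (t : R) (F : 'cV[R]_m -> 'cV[R]_m) :
  (forall v i, (fun n => (taylor B t n *m v) i 0) @ \oo --> F v i 0) ->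
  forall v, mexp B t *m v = F v.
Proof.
move=> h.
pose L : 'M[R]_m := \matrix_(i, j) F (delta_mx j 0) i 0.
have hL i j : (fun n => taylor B t n i j) @ \oo --> L i j.
  have := h (delta_mx j 0) i; rewrite mxE.
  by under eq_fun do rewrite -colE mxE.
have c : cvg (taylor B t @ \oo) by apply/cvg_ex; exists L; exact: cvg_mx_entries.
have E : mexp B t = L.
  apply/matrixP => i j.
  have c1 : (fun n => taylor B t n i j) @ \oo --> mexp B t i j.
    have cM : taylor B t @ \oo --> mexp B t by exact: c.
    apply: (@cvg_comp _ _ _ (taylor B t) (fun M : 'M[R]_m => M i j) _ _ _ cM).
    exact: (@coord_continuous R m m i j (mexp B t)).
  exact: (cvg_unique _ c1 (hL i j)).
move=> v; apply/colP => i; apply: (cvg_unique _ _ (h v i)) => //.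
rewrite E mxE (_ : (fun n => _) = fun n => \sum_j taylor B t n i j * v j 0).
  apply: (@cvg_sumr R _ _ (fun j n => taylor B t n i j * v j 0)) => j.
  apply: cvgM; [exact: hL|exact: cvg_cst].
by apply/funext => n; rewrite mxE.
Qed.

Lemma cvgC_Qpoly (R : realType) (m : nat) (N : 'M[R[i]]_m) (c t : R[i]) (u : 'cV[R[i]]_m) k i :
  N ^+ k *m u = 0 ->
  cvgC (fun n => Qpoly (N + c%:M) t n u i 0) (expC (t * c) * Qpoly N t k u i 0).
Proof.
(* Shifting by k makes the finite identity available at every index and turns the number of terms n
   + k - j into a shift of n. *)
move=> Nu; apply/(cvgC_shift _ _ k).
rewrite (_ : (fun n => _) = (fun n => \sum_(j < k) expS (t * c) (n + (k - j)) *
    ((t ^+ j / j`!%:R) *: (N ^+ j *m u)) i 0)); last first.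
  apply/funext => n; rewrite (taylor_nilpotentE _ _ Nu) ?leq_addl // summxE.
  by apply: eq_bigr => j _; rewrite [LHS]mxE addnBA // ltnW.
rewrite /Qpoly summxE mulr_sumr; apply: cvgC_sum => j.
apply: cvgCM; last exact: cvgC_cst.
by apply/(cvgC_shift (expS (t * c))); exact: cvgC_expS.
Qed.

Lemma complexify_mulmx_Re (R : realType) (m : nat) (M : 'M[R]_m) (u : 'cV[R[i]]_m) i :
  complex.Re ((complexify M *m u) i 0) = (M *m map_mx (@complex.Re R) u) i 0.
Proof.
rewrite !mxE (raddf_sum (@complex.Re R : Rcomplex R -> R)); apply: eq_bigr => j _.
by rewrite !mxE; case: (u j 0) => a b /=; rewrite mul0r subr0.
Qed.

Lemma complexify_mulmx_Im (R : realType) (m : nat) (M : 'M[R]_m) (u : 'cV[R[i]]_m) i :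
  complex.Im ((complexify M *m u) i 0) = (M *m map_mx (@complex.Im R) u) i 0.
Proof.
rewrite !mxE (raddf_sum (@complex.Im R : Rcomplex R -> R)); apply: eq_bigr => j _.
by rewrite !mxE; case: (u j 0) => a b /=; rewrite mul0r addr0.
Qed.

Lemma complexifyX (R : realType) (m : nat) (A : 'M[R]_m) k :
  complexify (A ^+ k) = complexify A ^+ k.
Proof.
elim: k => [|k IH]; first by rewrite !expr0 [LHS](map_scalar_mx (real_complex R)).
by rewrite !exprS -IH -!mulmxE [LHS](map_mxM (real_complex R)).
Qed.

Lemma complexify_sub (R : realType) (m : nat) (A : 'M[R]_m) r :
  complexify (A - r%:M) = complexify A - (r%:C)%:M.
Proof.
by rewrite [LHS](map_mxB (real_complex R)) (map_scalar_mx (real_complex R)).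
Qed.

Lemma complexify_taylor (R : realType) (m : nat) (B : 'M[R]_m) (t : R) n u :
  complexify (taylor B t n) *m u = Qpoly (complexify B) t%:C n.+1 u.
Proof.
rewrite /taylor /Qpoly [complexify _](raddf_sum (map_mx (real_complex R))) mulmx_suml.
apply: eq_bigr => k _.
rewrite /= (map_mxZ (real_complex R)) -scalemxAl -complexifyX; congr (_ *: _).
by rewrite rmorphM fmorphV rmorph_nat rmorphXn.
Qed.

Section GeneralizedEigenvector.
Variables (R : realType) (m : nat) (A : 'M[R]_m) (r t : R) (mu : R[i]).
Variables (u : 'cV[R[i]]_m) (k : nat).
Hypothesis hu : (complexify A - mu%:M) ^+ k *m u = 0.

(** Closed form of e^(t(A - r)) u for a generalized eigenvector u. Keeping r free covers e^(tA),
    with r = 0, and its rescaling, with r = s. *)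
Definition gexp (R : realType) (m : nat) (A : 'M[R]_m) (r t : R) (mu : R[i])
    (u : 'cV[R[i]]_m) (k : nat) : 'cV[R[i]]_m :=
  expC (t%:C * (mu - r%:C)) *: Qpoly (complexify A - mu%:M) t%:C k u.

Lemma cvgC_gexp i :
  cvgC (fun n => (complexify (taylor (A - r%:M) t n) *m u) i 0)
       (gexp A r t mu u k i 0).
Proof.
rewrite /gexp mxE.
have e : complexify A - mu%:M + (mu - r%:C)%:M = complexify (A - r%:M).
  by rewrite complexify_sub raddfB /= addrA subrK.
(* The shift by 1 is there because [taylor] at n has n + 1 terms and [Qpoly] at n has n. *)
have /(cvgC_shift _ _ 1) := @cvgC_Qpoly R m _ (mu - r%:C) t%:C u k i hu.
rewrite e (_ : (fun n => Qpoly _ _ (n + 1) _ _ _) =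
    fun n => (complexify (taylor (A - r%:M) t n) *m u) i 0) //.
by apply/funext => n; rewrite (complexify_taylor (A - r%:M)) addn1.
Qed.

Lemma cvg_taylor_Re i :
  (fun n => (taylor (A - r%:M) t n *m map_mx (@complex.Re R) u) i 0) @ \oo -->
  complex.Re (gexp A r t mu u k i 0).
Proof.
have [h _] := cvgC_gexp i.
by under eq_fun do rewrite -complexify_mulmx_Re.
Qed.

Lemma cvg_taylor_Im i :
  (fun n => (taylor (A - r%:M) t n *m map_mx (@complex.Im R) u) i 0) @ \oo -->
  complex.Im (gexp A r t mu u k i 0).
Proof.
have [_ h] := cvgC_gexp i.
by under eq_fun do rewrite -complexify_mulmx_Im.
Qed.
End GeneralizedEigenvector.

Section MatrixExponential.
Variables (R : realType) (m : nat) (A : 'M[R]_m.+1).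

Lemma real_gdecomp : exists2 S : seq R[i],
  uniq S /\ (forall mu, (mu \in S) = eigenvalue (complexify A) mu) &
  forall v : 'cV[R]_m.+1, exists k : R[i] -> nat, exists z : R[i] -> 'cV[R[i]]_m.+1,
    (forall mu, (complexify A - mu%:M) ^+ k mu *m z mu = 0) /\
    v = \sum_(mu <- S) map_mx (@complex.Re R) (z mu).
Proof.
have [S hS h] := gdecomp_exists (complexify A); exists S => // v.
have [k [z [hz e]]] := h (map_mx (real_complex R) v).
exists k, z; split=> //.
apply/colP => i; have /(congr1 (fun w : 'cV[R[i]]_m.+1 => complex.Re (w i 0))) := e.
rewrite mxE /= => ->; rewrite !summxE (raddf_sum (@complex.Re R : Rcomplex R -> R)).
by apply: eq_bigr => mu _; rewrite mxE.
Qed.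

(** One decomposition of v serves all r and t. It yields both the convergence and the law e^(t(A -
    r)) = e^(-rt) e^(tA), since r enters only through a scalar exponential. *)
Lemma mexp_spec : exists F : R -> R -> 'cV[R]_m.+1 -> 'cV[R]_m.+1,
  (forall r t v i, (fun n => (taylor (A - r%:M) t n *m v) i 0) @ \oo --> F r t v i 0) /\
  (forall r t v, F r t v = expR (- (r * t)) *: F 0 t v).
Proof.
have [S _ h] := real_gdecomp.
have [k hk] := choice h; have [z hz] := choice hk.
exists (fun r t v => \sum_(mu <- S) map_mx (@complex.Re R) (gexp A r t mu (z v mu) (k v mu))).
split=> [r t v i|r t v].
  have [h1 h2] := hz v; rewrite summxE {1}h2.
  rewrite (_ : (fun n => _) = fun n => \sum_(mu <- S)
      (taylor (A - r%:M) t n *m map_mx (@complex.Re R) (z v mu)) i 0).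
    apply: (@cvg_sumr R _ _ (fun mu n => (taylor (A - r%:M) t n *m
      map_mx (@complex.Re R) (z v mu)) i 0)) => mu.
    by rewrite mxE; apply: cvg_taylor_Re; exact: h1.
  by apply/funext => n; rewrite mulmx_sumr summxE.
rewrite scaler_sumr; apply: eq_bigr => mu _; apply/colP => i.
rewrite !mxE (_ : expC _ = (expR (- (r * t)))%:C * expC (t%:C * (mu - 0%:C))).
  by rewrite -mulrA; case: (_ * Qpoly _ _ _ _ _ _) => a b /=; rewrite mul0r subr0.
rewrite /expC mulrA -rmorphM /= -expRD; case: mu => a b /=.
by rewrite !(mul0r, mulr0, subr0, addr0, oppr0); congr ((expR _)%:C * _); ring.
Qed.

Lemma cvg_taylor r t (v : 'cV[R]_m.+1) i :
  (fun n => (taylor (A - r%:M) t n *m v) i 0) @ \oo --> (mexp (A - r%:M) t *m v) i 0.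
Proof.
have [F [hF _]] := mexp_spec.
by rewrite (@cvg_taylor_mulmx _ _ _ _ (F r t)).
Qed.

Lemma mexp_shift r t (v : 'cV[R]_m.+1) : mexp (A - r%:M) t *m v = expR (- (r * t)) *: (mexp A t *m v).
Proof.
have [F [hF hs]] := mexp_spec.
rewrite (@cvg_taylor_mulmx _ _ _ _ (F r t)) //.
rewrite (@cvg_taylor_mulmx _ _ _ _ (F 0 t)) // => w i.
have := hF 0 t w i; by rewrite raddf0 subr0.
Qed.

(** The Taylor sums applied to y are eventually constant. *)
Lemma mexp_nilpotent r t (y : 'cV[R]_m.+1) k : (A - r%:M) ^+ k *m y = 0 ->
  mexp (A - r%:M) t *m y = Qpoly (A - r%:M) t k y.
Proof.
move=> hy; apply/colP => i; rewrite -(cvg_lim (@Rhausdorff R) (@cvg_taylor r t y i)).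
apply: lim_near_cst => //; near=> n.
have kn : (k <= n.+1)%N by near: n; exists k => // j /= /leqW.
suff -> : taylor (A - r%:M) t n *m y = Qpoly (A - r%:M) t k y by [].
rewrite /taylor mulmx_suml /Qpoly.
rewrite (big_ord_widen n.+1 (fun j => (t ^+ j / j`!%:R) *: ((A - r%:M) ^+ j *m y))) //.
rewrite [RHS]big_mkcond /=; apply: eq_bigr => j _; rewrite -scalemxAl.
by case: ltnP => // kj; rewrite (expmx_mul0_le hy kj) !scaler0.
Unshelve. all: by end_near.
Qed.
End MatrixExponential.

(** * The spectral decomposition *)

Lemma exprn_div_fact_le_expR (R : realType) (x : R) k : 0 <= x -> x ^+ k / k`!%:R <= expR x.
Proof.
move=> x0; case: k => [|k].
  by rewrite expr0 divr1 -expR0 ler_expR.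
by apply: le_trans (expR_ge1Dxn k x0); rewrite lerDr.
Qed.

Lemma norm_expC (R : realType) (z : R[i]) : `|expC z| = (expR (complex.Re z))%:C.
Proof.
rewrite /expC normrM (normc_def (cos _ +i* _)) /= cos2Dsin2 sqrtr1 mulr1.
by rewrite normc_def /= expr0n /= addr0 sqrtr_sqr gtr0_norm ?expR_gt0.
Qed.

Lemma gexp_decay (R : realType) (m : nat) (A : 'M[R]_m) (s delta : R) (mu : R[i])
    (u : 'cV[R[i]]_m) k :
  0 < delta -> complex.Re mu <= s - 2 * delta ->
  exists C : R, forall t i, 1 <= t ->
    `|gexp A s t mu u k i 0| <= (C * expR (- (delta * t)))%:C.
Proof.
move=> d0 hmu.
pose N := complexify A - mu%:M.
pose c : R[i] := \sum_i \sum_(j < k) `|(N ^+ j *m u) i 0|.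
have c0 : 0 <= c by apply: sumr_ge0 => i _; apply: sumr_ge0.
have cE : c = (complex.Re c)%:C by rewrite RRe_real // ger0_real.
have Rc0 : 0 <= complex.Re c by rewrite -lecR -cE.
(* From (delta t)^k / k! <= e^(delta t) one has t^k <= (k! / delta^k) e^(delta t), which uses up one
   of the two delta in the gap. The other factor bounds the coefficient vectors, uniformly in the
   entry. *)
exists (k`!%:R / delta ^+ k * complex.Re c) => t i t1.
have t0 : 0 <= t by exact: le_trans t1.
have hQ : `|Qpoly N t%:C k u i 0| <= (t ^+ k)%:C * c.
  rewrite /Qpoly summxE; apply: le_trans (ler_norm_sum _ _ _) _.
  apply: (@le_trans _ _ (\sum_(j < k) (t ^+ k)%:C * `|(N ^+ j *m u) i 0|)).
    apply: ler_sum => j _; rewrite mxE normrM; apply: ler_wpM2r => //.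
    have -> : (t%:C ^+ j / j`!%:R : R[i]) = (t ^+ j / j`!%:R)%:C.
      by rewrite rmorphM fmorphV rmorph_nat rmorphXn.
    rewrite ger0_norm ?lecR ?divr_ge0 ?exprn_ge0 // ler_pdivrMr ?ltr0n ?fact_gt0 //.
    apply: (@le_trans _ _ (t ^+ k)); first by rewrite ler_weXn2l // ltnW.
    by rewrite ler_peMr ?exprn_ge0 // ler1n fact_gt0.
  rewrite -mulr_sumr; apply: ler_wpM2l; first by rewrite lecR exprn_ge0.
  rewrite /c (bigD1 i) //= lerDl; apply: sumr_ge0 => ? _; exact: sumr_ge0.
rewrite /gexp mxE normrM norm_expC.
have -> : complex.Re (t%:C * (mu - s%:C)) = t * (complex.Re mu - s).
  by case: mu {hmu hQ cE Rc0 c0 c N} => a b /=; rewrite mul0r subr0.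
apply: le_trans (ler_wpM2l _ hQ) _; first by rewrite lecR expR_ge0.
rewrite cE -!rmorphM lecR mulrA [X in _ <= X]mulrAC; apply: ler_wpM2r => //.
have h := exprn_div_fact_le_expR k (mulr_ge0 (ltW d0) t0).
have h2 : t ^+ k <= k`!%:R / delta ^+ k * expR (delta * t).
  rewrite mulrAC ler_pdivlMr ?exprn_gt0 // -exprMn [t * _]mulrC.
  rewrite ler_pdivrMr ?ltr0n ?fact_gt0 // in h.
  by rewrite [X in _ <= X]mulrC.
apply: le_trans (ler_wpM2l (expR_ge0 _) h2) _.
rewrite mulrCA; apply: ler_wpM2l; first by rewrite divr_ge0 ?exprn_ge0 // ltW.
by rewrite -expRD ler_expR; nra.
Qed.

Lemma cvg_mnorm (R : realType) (m : nat) (u : nat -> 'M[R]_m) (L : 'M[R]_m) :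
  (forall i j, (fun n => u n i j) @ \oo --> L i j) ->
  (fun n => mnorm (u n)) @ \oo --> mnorm L.
Proof.
move=> h.
have hs : (fun n => mdot (u n) (u n)) @ \oo --> mdot L L.
  rewrite mdotE (_ : (fun n => _) = fun n => \sum_(p : 'I_m * 'I_m) u n p.2 p.1 * u n p.2 p.1).
    apply: (@cvg_sumr R _ _ (fun p n => u n p.2 p.1 * u n p.2 p.1)) => p.
    by apply: cvgM; exact: h.
  by apply/funext => n; rewrite mdotE.
exact: (cvg_comp _ _ hs (@sqrt_continuous R _)).
Qed.

Section Spectral.
Variables (R : realType) (m : nat) (A : 'M[R]_m.+1).
Local Notation s := (spec_abscissa A).
Local Notation N := (A - s%:M).
Hypothesis pA : perron_like A.

(** Shows that [xget] does not fall back on its default. The witness is the real part of the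
    component at s: A and s are real, so taking real parts commutes with powers of A - s. *)
Lemma Pi1P (x : 'cV[R]_m.+1) : E1 A (Pi1 A x) /\ E2 A (x - Pi1 A x).
Proof.
rewrite /Pi1; apply: (xgetPex 0 (P := [set y | E1 A y /\ E2 A (x - y)])).
have [S [uS hS] h] := real_gdecomp A.
have [k [z [hz e]]] := h x.
have sS : s%:C \in S by rewrite hS; exact: pA.1.
exists (map_mx (@complex.Re R) (z s%:C)); split.
  (* The exponent is increased by one because [GE_real] wants it positive. *)
  exists (k s%:C).+1 => //; apply/colP => i.
  rewrite -complexify_mulmx_Re complexifyX complexify_sub exprS -mulmxE -mulmxA hz.
  by rewrite mulmx0 !mxE.
exists (fun mu => map_mx (@complex.Re R) (z mu)); split.
  move=> mu _; exists (z mu); split; last by left.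
  by exists (k mu).+1 => //; rewrite exprS -mulmxE -mulmxA hz mulmx0.
rewrite [in LHS]e (bigD1_seq s%:C) //= addrAC subrr add0r.
rewrite -big_filter fsbig_seq ?filter_uniq //.
suff -> : [set` [seq mu <- S | mu != s%:C]] = spectrum A `\ s%:C by [].
apply/seteqP; split=> mu /=.
  by rewrite mem_filter hS => /andP[/eqP ? ?].
by case=> h1 h2; rewrite mem_filter hS h1 andbT; apply/eqP.
Qed.

(** The kernels of the powers of A - s stabilize, so some power kills E1, and a least such exponent
    exists. *)
Lemma cordP : (1 <= cord A)%N /\ kills_E1 A (cord A).
Proof.
have [k hk] := expmx_kernel_stable A s.
have kill : kills_E1 A k.+1.
  apply/seteqP; split=> [x /= [y [j _ hy] <-]|x /= ->].
    by rewrite exprS -mulmxE -mulmxA (hk j) // mulmx0.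
  by exists 0; [exists 1%N; rewrite ?mulmx0|rewrite mulmx0].
have ex : exists n, `[< (1 <= n)%N /\ kills_E1 A n >] by exists k.+1; apply/asboolP.
case: (ex_minnP ex) => n /asboolP[n1 kn] mn.
suff : [/\ (1 <= cord A)%N, kills_E1 A (cord A) &
    forall k : nat, (1 <= k)%N -> kills_E1 A k -> (cord A <= k)%N] by case.
apply: (xgetPex 1%N (P := [set nu : nat | [/\ (1 <= nu)%N, kills_E1 A nu &
    forall k : nat, (1 <= k)%N -> kills_E1 A k -> (nu <= k)%N]])).
by exists n; split=> // j j1 kj; apply: mn; apply/asboolP.
Qed.

Lemma cord_kills (y : 'cV[R]_m.+1) : E1 A y -> N ^+ cord A *m y = 0.
Proof.
move=> hy; have [_] := cordP.
by rewrite /kills_E1 => /seteqP[h _]; apply: h; exists y.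
Qed.

(** Vectors with such a bound are closed under addition, which reduces the claim to one generalized
    eigenvector and its real and imaginary parts. *)
Lemma E2_decay (delta : R) (x : 'cV[R]_m.+1) : 0 < delta ->
  (forall mu : R[i], (spectrum A `\ s%:C) mu -> complex.Re mu <= s - 2 * delta) ->
  E2 A x ->
  exists C : R, forall t i, 1 <= t ->
    `|(mexp N t *m x) i 0| <= C * expR (- (delta * t)).
Proof.
move=> d0 hd.
pose P (x : 'cV[R]_m.+1) := exists C : R, forall t i, 1 <= t ->
    `|(mexp N t *m x) i 0| <= C * expR (- (delta * t)).
have P0 : P 0 by exists 0 => t i _; rewrite mulmx0 mxE normr0 mul0r.
have PD y z : P y -> P z -> P (y + z).
  move=> [C1 h1] [C2 h2]; exists (C1 + C2) => t i t1.
  rewrite mulmxDr mxE mulrDl; apply: le_trans (ler_normD _ _) _.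
  by apply: lerD; [exact: h1|exact: h2].
have PG mu y : (spectrum A `\ s%:C) mu -> GE A mu y -> P y.
  move=> /hd hmu [u [[k _ hu] hy]].
  have [C hC] := gexp_decay A u k d0 hmu; exists C => t i t1.
  rewrite -lecR; apply: le_trans (hC t i t1).
  case: hy => ->.
    rewrite (cvg_unique _ (@cvg_taylor _ _ A s t _ i) (@cvg_taylor_Re _ _ _ s t _ _ _ hu i)) //.
    exact: normc_ge_Re.
  rewrite (cvg_unique _ (@cvg_taylor _ _ A s t _ i) (@cvg_taylor_Im _ _ _ s t _ _ _ hu i)) //.
  rewrite normc_def lecR -sqrtr_sqr ler_wsqrtr // lerDr; exact: sqr_ge0.
move=> [z [hz ->]]; change (P (\sum_(mu \in spectrum A `\ s%:C) z mu)).
(* The first case is the convention that a sum with infinite support is 0. *)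
case: finite_supportP => [_|X XD _ _]; first by rewrite big_nil.
rewrite big_seq; apply: big_ind => // mu muX.
by apply: (PG mu); [|apply: hz]; apply: XD.
Qed.
End Spectral.

(** * Asymptotics of the normalized exponential *)

Section OfCols.
Variables (R : realType) (m : nat).

Lemma of_cols_mulmx (M : 'M[R]_m) (f : 'I_m -> 'cV[R]_m) :
  of_cols (fun i => M *m f i) = M *m of_cols f.
Proof.
by apply/matrixP => i j; rewrite !mxE; apply: eq_bigr => l _; rewrite mxE.
Qed.

Lemma of_colsZ (a : R) (f : 'I_m -> 'cV[R]_m) :
  of_cols (fun i => a *: f i) = a *: of_cols f.
Proof. by apply/matrixP => i j; rewrite !mxE. Qed.

Lemma mulmx_colE (M V : 'M[R]_m) i j : (M *m V) i j = (M *m col j V) i 0.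
Proof. by rewrite !mxE; apply: eq_bigr => l _; rewrite mxE. Qed.

Lemma col_of_cols (f : 'I_m -> 'cV[R]_m) i : col i (of_cols f) = f i.
Proof. by apply/colP => j; rewrite !mxE. Qed.
End OfCols.

Lemma mexp_shift_mx (R : realType) (m : nat) (A V : 'M[R]_m.+1) (r t : R) :
  mexp (A - r%:M) t *m V = expR (- (r * t)) *: (mexp A t *m V).
Proof.
apply/matrixP => i j; rewrite mulmx_colE mexp_shift.
rewrite [RHS]mxE.
rewrite [X in _ = _ * X]mulmx_colE.
by rewrite [LHS]mxE.
Qed.

(** The bound on X_(n+p) - X_n is uniform in p; let p tend to infinity. *)
Lemma Xn_sub_mexp (R : realType) (m : nat) (A V : 'M[R]_m.+1) (t : R) n : 0 <= t ->
  mnorm V = 1 ->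
  mnorm (Xn A V n t - mexp A t *m V) <=
    (t * mnorm A) ^+ n.+1 / n.+1`!%:R * expR (t * mnorm A).
Proof.
move=> t0 V1.
have XnE p : Xn A V p t = taylor A t p *m V.
  by rewrite /Xn /taylor mulmx_suml; apply: eq_bigr => k _; rewrite scalemxAl.
have c : (fun p => mnorm (Xn A V (p + n) t - Xn A V n t)) @ \oo -->
    mnorm (mexp A t *m V - Xn A V n t).
  apply: cvg_mnorm => i j.
  rewrite mxE (_ : (fun p => _) = fun p => Xn A V (p + n) t i j + (- Xn A V n t) i j); last first.
    by apply/funext => p; rewrite mxE.
  apply: cvgD; last exact: cvg_cst.
  rewrite (cvg_shiftn n (fun p => Xn A V p t i j)) mulmx_colE.
  under eq_fun do rewrite XnE mulmx_colE.
  by have := @cvg_taylor _ _ A 0 t (col j V) i; rewrite raddf0 subr0.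
rewrite mnorm_distrC -(cvg_lim (@Rhausdorff R) c); apply: limr_le.
  by apply/cvg_ex; eexists; exact: c.
by near=> p; rewrite addnC Xn_diff.
Unshelve. all: by end_near.
Qed.

(** Here the infinitesimal originates: [stir] is exactly the factor that turns the power in theta
    into the leading term of the Taylor remainder. *)
Lemma thetaE (R : realType) (m : nat) (A : 'M[R]_m) (kappa : R) n t :
  theta A kappa n t * stir R n.+1 =
  kappa^-1 * expR (2 * mnorm A * t) * ((t * mnorm A) ^+ n.+1 / n.+1`!%:R).
Proof.
rewrite /theta /stir -[LHS]mulrA; congr (_ * _).
rewrite mulrA -exprMn; congr (_ ^+ _ / _).
have e0 : expR 1 != 0 :> R by rewrite expR_eq0.
by field; rewrite e0 -(natrD _ 1 n) pnatr_eq0.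
Qed.

Section Main.
Variables (R : realType) (m : nat) (A V : 'M[R]_m.+1) (delta kappa : R).
Local Notation s := (spec_abscissa A).
Local Notation N := (A - s%:M).
Hypothesis pA : perron_like A.
Hypothesis d0 : 0 < delta.
Hypothesis hd : forall mu : R[i], (spectrum A `\ s%:C) mu ->
  complex.Re mu <= s - 2 * delta.
Hypothesis V1 : mnorm V = 1.
Hypothesis hk : is_kappa A V kappa.

Let Y := of_cols (yvec A V).
Let p := (cord A).-1.
Let W : 'M[R]_m.+1 := (p`!%:R)^-1 *: (N ^+ p *m Y).
Let k0 : 0 < kappa := hk.1.

Let cordE : cord A = p.+1.
Proof. by have [h _] := cordP A; rewrite /p prednK. Qed.

Let Nyvec i : N ^+ p.+1 *m yvec A V i = 0.
Proof. by rewrite -cordE; apply: cord_kills; have [] := Pi1P pA (col i V). Qed.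

Let NW : N *m W = 0.
Proof.
rewrite /W -scalemxAr mulmxA mulmxE -exprS -mulmxE.
apply/matrixP => i j; rewrite mxE mulmx_colE col_of_cols Nyvec !mxE mulr0 //.
Qed.

Let QYE t : QY A V t = \sum_(j < p.+1) (t ^+ j / j`!%:R) *: (N ^+ j *m Y).
Proof.
apply/matrixP => i j; rewrite mxE (mexp_nilpotent _ (Nyvec j)) /Qpoly !summxE.
by apply: eq_bigr => l _; rewrite mxE [RHS]mxE mulmx_colE col_of_cols.
Qed.

Lemma XiE : Xi A V = normalize W.
Proof.
have WE : W = of_cols (wvec A V).
  by rewrite /W /Y -of_cols_mulmx -of_colsZ.
rewrite /Xi of_colsZ -WE /normalize; congr (_^-1 *: _).
rewrite /omega /mnorm /mdot; congr (Num.sqrt _); apply: eq_bigr => i _.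
rewrite /vnorm sqr_sqrtr; first by rewrite WE col_of_cols.
by apply: sumr_ge0 => j _; rewrite -expr2 sqr_ge0.
Qed.

(** W is the coefficient of the top power t^p. Each lower term, divided by t^p, is at most 1/t times
    its coefficient, since j + 1 <= p and t >= 1. *)
Lemma QY_asymptotics : exists2 C : R, 0 <= C & forall t, 1 <= t ->
  mnorm (t ^- p *: QY A V t - W) <= C / t.
Proof.
exists (\sum_(j < p) mnorm (N ^+ j *m Y)).
  by apply: sumr_ge0 => j _; exact: mnorm_ge0.
move=> t t1; have t0 : 0 < t by exact: lt_le_trans t1.
rewrite QYE big_ord_recr /= scalerDr [X in _ + X - _]scalerA mulrA mulVf ?expf_neq0 ?gt_eqF //.
rewrite mul1r addrK scaler_sumr mulr_suml.
apply: le_trans (ler_mnorm_sum _ _) _; apply: ler_sum => j _.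
rewrite scalerA mnormZ mulrC; apply: ler_wpM2l; first exact: mnorm_ge0.
rewrite ger0_norm; last by rewrite mulr_ge0 ?invr_ge0 ?divr_ge0 ?exprn_ge0 ?ltW.
rewrite ler_pdivrMl ?exprn_gt0 // ler_pdivlMr // mulrC.
apply: (@le_trans _ _ (t ^+ j.+1)); last by rewrite ler_weXn2l // ltn_ord.
rewrite exprS ler_pM ?(ltW t0) ?divr_ge0 ?exprn_ge0 ?(ltW t0) //.
by rewrite ler_pdivrMr ?ltr0n ?fact_gt0 // ler_peMr ?exprn_ge0 ?(ltW t0) // ler1n fact_gt0.
Qed.

(* t^-p |Q_Y(t)| stays above kappa and tends to |W|. *)
Lemma W_gt0 : 0 < mnorm W.
Proof.
have [C C0 hC] := QY_asymptotics.
rewrite lt_def mnorm_ge0 andbT; apply/eqP => W0.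
(* Chosen so that kappa t = kappa + C, against kappa t <= C. *)
pose t := 1 + C / kappa.
have t1 : 1 <= t by rewrite lerDl divr_ge0 // ltW.
have t0 : 0 < t by exact: lt_le_trans t1.
have [_ h] := hk.2 t t1.
have h1 : t ^- p * mnorm (QY A V t) <= C / t.
  have := le_trans (ler_mnormB _ _) (hC t t1).
  by rewrite W0 subr0 mnormZ ger0_norm ?invr_ge0 ?exprn_ge0 // ltW.
have := le_trans h h1; rewrite ler_pdivlMr // /t mulrDr mulr1 mulrCA mulfV ?gt_eqF // mulr1.
by rewrite gerDr leNgt k0.
Qed.

Lemma AW : A *m W = s *: W.
Proof. by have /eqP := NW; rewrite mulmxBl mul_scalar_mx subr_eq0 => /eqP. Qed.

(** Compare norms in A W = s W with W nonzero. *)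
Lemma mnorm_abscissa : `|s| <= mnorm A.
Proof.
have := mnorm_mulmx A W; rewrite AW mnormZ.
by rewrite ler_pM2r // W_gt0.
Qed.

Lemma mexp_lower t : 1 <= t -> kappa * expR (- (t * mnorm A)) <= mnorm (mexp A t *m V).
Proof.
move=> t1; have [h _] := hk.2 t t1.
have t0 : 0 < t by exact: lt_le_trans t1.
have X0 := mnorm_ge0 (mexp A t *m V).
have h1 : kappa <= expR (- (s * t)) * mnorm (mexp A t *m V).
  apply: le_trans h _; apply: ler_wpM2r => //.
  rewrite ler_piMr ?expR_ge0 // invf_le1 ?exprn_gt0 //.
  by rewrite exprn_ege1.
have h2 : expR (- (s * t)) <= expR (t * mnorm A).
  rewrite ler_expR -mulNr mulrC; apply: ler_wpM2l; first exact: ltW.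
  by apply: le_trans mnorm_abscissa; rewrite -normrN ler_norm.
rewrite expRN ler_pdivrMr ?expR_gt0 // mulrC.
by apply: le_trans h1 _; apply: ler_wpM2r.
Qed.

(** One factor e^(|A| t) of theta comes from the Taylor remainder, the other from the lower bound on
    |e^(tA) V|; the 2 comes from normalization. *)
Lemma normalize_Xn_sub n t : 1 <= t ->
  mnorm (normalize (Xn A V n t) - normalize (mexp A t *m V)) <=
  theta A kappa n t * (2 * stir R n.+1).
Proof.
move=> t1; have t0 : 0 <= t by exact: le_trans t1.
have lo := mexp_lower t1.
have lo0 : 0 < kappa * expR (- (t * mnorm A)) by rewrite mulr_gt0 ?expR_gt0.
have X0 : 0 < mnorm (mexp A t *m V) by exact: lt_le_trans lo.
apply: le_trans (normalize_lipschitz _ X0) _.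
rewrite [X in _ <= X]mulrCA; apply: ler_wpM2l => //.
rewrite thetaE ler_pdivrMr //.
apply: le_trans (Xn_sub_mexp _ n t0 V1) _.
set b := _ / _; have b0 : 0 <= b by rewrite divr_ge0 ?exprn_ge0 ?mulr_ge0 ?mnorm_ge0.
apply: le_trans (ler_wpM2l _ lo); last by rewrite mulr_ge0 // mulr_ge0 ?expR_ge0 ?invr_ge0 ?ltW.
rewrite le_eqVlt; apply/orP; left; apply/eqP.
have -> : expR (2 * mnorm A * t) = expR (t * mnorm A) * expR (t * mnorm A).
  by rewrite -expRD; congr expR; ring.
rewrite expRN; field.
by rewrite expR_eq0 gt_eqF.
Qed.

Lemma normalize_mexp_sub_q : exists2 B : R, 0 <= B & forall t, 1 <= t ->
  mnorm (normalize (mexp A t *m V) - q A V t) <= B * expR (- (delta * t)).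
Proof.
have /choice [C hC] : forall j, exists C : R, forall t i, 1 <= t ->
    `|(mexp N t *m (col j V - yvec A V j)) i 0| <= C * expR (- (delta * t)).
  by move=> j; apply: (E2_decay d0 hd); have [] := Pi1P pA (col j V).
(* The C j carry no sign, so absolute values are summed to get one constant for all columns; m + 1
   then comes from passing from entries to the norm. *)
pose D := \sum_j `|C j|.
have D0 : 0 <= D by apply: sumr_ge0.
exists (2 * (m.+1%:R * D / kappa)).
  by rewrite !mulr_ge0 ?ler0n // invr_ge0 ltW.
move=> t t1; have t0 : 0 < t by exact: lt_le_trans t1.
have -> : normalize (mexp A t *m V) = normalize (mexp N t *m V).
  by rewrite mexp_shift_mx normalizeZ ?expR_gt0.
have q0 : kappa <= mnorm (QY A V t).
  have [_ h] := hk.2 t t1; apply: le_trans h _.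
  by rewrite ler_piMl ?mnorm_ge0 // invf_le1 ?exprn_gt0 // exprn_ege1.
apply: le_trans (normalize_lipschitz _ (lt_le_trans k0 q0)) _.
rewrite -[X in _ <= X]mulrA; apply: ler_wpM2l => //.
apply: (@le_trans _ _ (mnorm (mexp N t *m V - QY A V t) / kappa)).
  by apply: ler_wpM2l; [exact: mnorm_ge0|rewrite lef_pV2 ?posrE // (lt_le_trans k0)].
rewrite mulrAC; apply: ler_wpM2r; first by rewrite invr_ge0 ltW.
rewrite -mulrA; apply: mnorm_le_entries => i j.
have -> : (mexp N t *m V - QY A V t) i j = (mexp N t *m (col j V - yvec A V j)) i 0.
  by rewrite mulmxBr mxE mulmx_colE [in RHS]mxE; congr (_ + _); rewrite !mxE.
apply: le_trans (hC j t i t1) _; apply: ler_wpM2r; first exact: expR_ge0.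
rewrite /D (bigD1 j) //=; apply: le_trans (ler_norm _) _.
by rewrite lerDl; apply: sumr_ge0.
Qed.

Lemma q_sub_Xi : exists2 C : R, 0 <= C & forall t, 1 <= t ->
  mnorm (q A V t - Xi A V) <= C / t.
Proof.
have [C C0 hC] := QY_asymptotics; exists (2 * (C / kappa)).
  by rewrite mulr_ge0 // divr_ge0 // ltW.
move=> t t1; have t0 : 0 < t by exact: lt_le_trans t1.
have tp : 0 < t ^- p by rewrite invr_gt0 exprn_gt0.
have [_ h] := hk.2 t t1.
have lo : kappa <= mnorm (t ^- p *: QY A V t) by rewrite mnormZ gtr0_norm.
(* Scaling by t^-p leaves q(t) unchanged. The difference is reversed so that the denominator is t^-p
   |Q_Y(t)|, which kappa bounds from below. *)
rewrite XiE /q -(normalizeZ (QY A V t) tp) mnorm_distrC.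
apply: le_trans (normalize_lipschitz _ (lt_le_trans k0 lo)) _.
rewrite mnorm_distrC -mulrA; apply: ler_wpM2l => //.
rewrite mulrAC; apply: ler_pM; rewrite ?mnorm_ge0 ?invr_ge0 ?mnorm_ge0 ?hC //.
by rewrite lef_pV2 ?posrE // (lt_le_trans k0).
Qed.

Lemma mdot_Xi : mdot (A *m Xi A V) (Xi A V) = s.
Proof.
rewrite XiE /normalize -scalemxAr AW scalerA mulrC -scalerA mdotZl -mnorm_sqr.
by rewrite (mnorm_normalize W_gt0) expr1n mulr1.
Qed.
End Main.

Theorem theorem4p1 (R : realType) :
  exists2 o1 : nat -> R, o1 @ \oo --> (0 : R) &
  forall (m : nat) (A : 'M[R]_m) (delta : R) (V : 'M[R]_m) (kappa : R),
    perron_like A ->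
    0 < delta ->
    (forall mu : R[i], (spectrum A `\ (spec_abscissa A)%:C) mu ->
       complex.Re mu <= spec_abscissa A - 2 * delta) ->
    V \in unitmx ->
    mnorm V = 1 ->
    is_kappa A V kappa ->
    exists B0 B1 B2 C1 C2 : R,
      [/\ 0 < B0, 0 < B1, 0 < B2, 0 < C1 & 0 < C2] /\
      forall (n : nat) (t : R), 1 <= t ->
        [/\ mnorm (normalize (Xn A V n t) - q A V t)
              <= B0 * expR (- (delta * t)) + theta A kappa n t * o1 n,
            mnorm (normalize (Xn A V n t) - Xi A V)
              <= C1 * t^-1 + B1 * expR (- (delta * t))
                 + theta A kappa n t * o1 n
          & `|(mnorm (Xn A V n t) ^+ 2)^-1 *
                mdot (A *m Xn A V n t) (Xn A V n t) - spec_abscissa A|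
              <= C2 * t^-1 + B2 * expR (- (delta * t))
                 + mnorm A * theta A kappa n t * o1 n].
Proof.
(* Normalization costs a factor 2, and the quadratic form, with Lipschitz constant 2 |A| on the unit
   ball, another 2; the same infinitesimal then serves all three estimates. *)
exists (fun n => 4 * stir R n.+1).
  by rewrite -[X in _ --> X](mulr0 4); apply: cvgM; [exact: cvg_cst|exact: cvg_stir].
move=> [|m] A delta V kappa pA d0 hd _ V1 hk.
  (* A matrix of size 0 has no eigenvalue, hence is not Perron-like. *)
  have [/eigenvalueP[v _]] := pA.
  by rewrite thinmx0 eqxx.
have [B B0 hB] := normalize_mexp_sub_q pA d0 hd hk.
have [C C0 hC] := q_sub_Xi pA hk.
set a := mnorm A; have a0 : 0 <= a := mnorm_ge0 A.
(* B, C and |A| are only known to be nonnegative; adding 1 makes the constants positive. *)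
exists (B + 1), (B + 1), (2 * a * B + 1), (C + 1), (2 * a * C + 1); split.
  by split; rewrite ltr_wpDl // !mulr_ge0.
move=> n t t1; have t0 : 0 < t by exact: lt_le_trans t1.
set x := normalize (Xn A V n t); set th := theta A kappa n t.
set d := stir R n.+1; set e := expR _.
have e0 : 0 <= e := expR_ge0 _.
have ti0 : 0 <= t^-1 by rewrite invr_ge0 ltW.
have th0 : 0 <= th * d.
  rewrite thetaE !mulr_ge0 ?invr_ge0 ?exprn_ge0 ?expR_ge0 ?mulr_ge0 ?mnorm_ge0 ?(ltW t0) //.
  by rewrite ltW // hk.1.
have h1 : mnorm (x - q A V t) <= B * e + 2 * (th * d).
  have hx := normalize_Xn_sub pA V1 hk n t1; have hX := hB t t1.
  apply: le_trans (ler_mnorm_dist3 x (normalize (mexp A t *m V)) (q A V t)) _.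
  by rewrite addrC; apply: lerD hX _; rewrite [leRHS]mulrCA.
have h2 : mnorm (x - Xi A V) <= C * t^-1 + B * e + 2 * (th * d).
  apply: le_trans (ler_mnorm_dist3 x (q A V t) (Xi A V)) _.
  by rewrite addrC -[leRHS]addrA; apply: lerD (hC t t1) h1.
have h3 : `|mdot (A *m x) x - spec_abscissa A| <= 2 * a * (C * t^-1 + B * e + 2 * (th * d)).
  rewrite -(mdot_Xi pA hk).
  apply: le_trans (mdot_mul_lipschitz _ _ _) _; rewrite ?mnorm_normalize_le1 //.
    by rewrite XiE ?mnorm_normalize_le1.
  by apply: ler_wpM2l h2; rewrite mulr_ge0.
split; first by nra.
- by nra.
(* The Rayleigh quotient is homogeneous of degree 0; for X_n(t) = 0 both sides are 0 because 0^-1 =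
   0. *)
have -> : (mnorm (Xn A V n t) ^+ 2)^-1 * mdot (A *m Xn A V n t) (Xn A V n t)
    = mdot (A *m x) x.
  by rewrite /x /normalize -scalemxAr mdotZl mdotZr mulrA -expr2 exprVn.
by apply: le_trans h3 _; nra.
Qed.
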